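(* Let $X$ be a real B-convex Banach space, let $(\Omega,\Sigma,\mu)$ be a probability space, and let $U\in BC(X)$ be a set whose closed linear span is finite-dimensional. Then for every uniformly bounded independent sequence of random sets $\Psi_n:\Omega\to BC(X)$, $n\in\mathbb N$, with mathematical expectations $E(\Psi_n)=U$ for all $n$, one has $$ \rho_H\left(\frac1n\sum_{i=1}^n\Psi_i(\omega),\ U\right)\xrightarrow[n\to\infty]{}0\quad\text{for almost every }\omega\in\Omega . $$
   Context: A Banach space $X$ is B-convex if there are $n\in\mathbb N$, $n\ge2$, and $\varepsilon>0$ such that for all $x_1,\dots,x_n$ in the unit ball of $X$ there is a choice of signs with $\|\sum_{i=1}^n\pm x_i\|\le(1-\varepsilon)n$. For a nonempty bounded $A\subset X$, $\|A\|=\sup_{a\in A}\|a\|$; a sequence $\Psi_n$ is uniformly bounded if $\sup_{n,\omega}\|\Psi_n(\omega)\|<\infty$. Sums of sets are Minkowski sums, $tA=\{ta:a\in A\}$. $\rho_H$ is the Hausdorff distance, $\rho_H(A,B)=\max\{\sup_{b\in B}\inf_{a\in A}\|a-b\|,\ \sup_{a\in A}\inf_{b\in B}\|a-b\|\}$. $BC(X)$ is the set of all nonempty bounded convex subsets of $X$, where sets $A,B$ with $\rho_H(A,B)=0$ (equivalently, with the same closure) are identified; it is a metric space under $\rho_H$, with the operations induced by Minkowski sum and multiplication by positive scalars. $Z(X)$ is the Banach space of bounded continuous real functions on the unit sphere $S_{X^*}$ of the dual, with the sup norm. The Rådström embedding $R:BC(X)\to Z(X)$ is $(R(A))(x^*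 )=\sup_{a\in A}x^*(a)$; it is isometric and additive, and positively homogeneous. A multifunction $F:\Omega\to BC(X)$ is a random set if $(R\circ F)^{-1}(G)\in\Sigma$ for every open $G\subset Z(X)$. It has mathematical expectation $E(F)=A\in BC(X)$ if $R\circ F$ is Bochner integrable with $\int_\Omega R\circ F\,d\mu=R(A)$. Random sets $F_n$ are independent if the random vectors $R\circ F_n$ are independent. *)

(* Defs.v *)
From HB Require Import structures.
From mathcomp Require Import all_boot all_order all_algebra finmap.
From mathcomp Require Import all_classical all_reals all_analysis.

Set Implicit Arguments.
Unset Strict Implicit.
Unset Printing Implicit Defensive.

Import Order.TTheory GRing.Theory Num.Theory.
Import numFieldNormedType.Exports.

Local Open Scope classical_set_scope.
Local Open Scope ring_scope.

Section sup_norm.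
Context (R : realType) (T : Type).
Implicit Types (D : set T) (f g : T -> R).

(* Equal to 0 when [D] is empty. *)
Definition sup_norm D f : R := sup [set `|f x| | x in D].

Lemma sup_norm_ge D f (M : R) x :
  (forall y, D y -> `|f y| <= M) -> D x -> `|f x| <= sup_norm D f.
Proof.
move=> fM Dx; apply: ub_le_sup; last by exists x.
by exists M => _ [y Dy <-]; exact: fM.
Qed.

Lemma sup_norm_le D f (M : R) :
  0 <= M -> (forall x, D x -> `|f x| <= M) -> sup_norm D f <= M.
Proof.
move=> M0 fM; rewrite /sup_norm; have [D0|D0] := eqVneq D set0.
  by rewrite D0 image_set0 sup0.
apply: ge_sup; last by move=> _ [x Dx <-]; exact: fM.
by have /set0P[x Dx] := D0; exists `|f x|, x.
Qed.

Lemma sup_norm_ge0 D f : 0 <= sup_norm D f.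
Proof.
have [E|E] := pselect (has_sup [set `|f x| | x in D]); last first.
  by rewrite /sup_norm sup_out.
have [[y yD] ub] := E; case: (yD) => x Dx xy.
rewrite (le_trans (normr_ge0 (f x)))// xy; exact: ub_le_sup.
Qed.

Lemma sup_normD D f g (M N : R) :
  (forall x, D x -> `|f x| <= M) -> (forall x, D x -> `|g x| <= N) ->
  sup_norm D (fun x => f x + g x) <= sup_norm D f + sup_norm D g.
Proof.
move=> fM gN; apply: sup_norm_le => [|x Dx].
  by rewrite addr_ge0// sup_norm_ge0.
by rewrite (le_trans (ler_normD _ _))// lerD//;
   [exact: sup_norm_ge fM _|exact: sup_norm_ge gN _].
Qed.

Lemma sup_normZ D f (M l : R) : (forall x, D x -> `|f x| <= M) ->
  sup_norm D (fun x => l * f x) = `|l| * sup_norm D f.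
Proof.
move=> fM; apply/eqP; rewrite eq_le; apply/andP; split.
  apply: sup_norm_le => [|x Dx]; first by rewrite mulr_ge0// sup_norm_ge0.
  by rewrite normrM ler_wpM2l//; exact: sup_norm_ge fM _.
have [->|l0] := eqVneq l 0; first by rewrite normr0 mul0r sup_norm_ge0.
have nl0 : 0 < `|l| by rewrite normr_gt0.
rewrite -ler_pdivlMl//; apply: sup_norm_le => [|x Dx].
  by rewrite mulr_ge0 ?sup_norm_ge0// invr_ge0 ltW.
rewrite ler_pdivlMl// -normrM.
apply: (@sup_norm_ge D (fun y => l * f y) (`|l| * M)) => // y Dy.
by rewrite normrM ler_wpM2l// fM.
Qed.

End sup_norm.

(** The dual space X^* of continuous linear functionals, with the operator
    norm. *)
Section dual.
Context (R : realType) (X : normedModType R).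

Definition dual_pred : {pred X -> R^o} :=
  mem [set f : X -> R^o | linear f /\ continuous f].

Record dual := Dual { dual_fun :> X -> R^o; dualP : dual_fun \in dual_pred }.

HB.instance Definition _ := [isSub for dual_fun].
HB.instance Definition _ := [Choice of dual by <:].

Lemma dual_submod_closed : submod_closed dual_pred.
Proof.
split; first by rewrite inE; split=> [a u v|x];
  [rewrite /= scaler0 addr0|exact: cst_continuous].
move=> a f g; rewrite !inE => -[lf cf] [lg cg]; split.
  move=> b u v; rewrite !fctE lf lg /GRing.scale/=.
  by rewrite !mulrDr addrACA [X in X + _ + _]mulrCA.
move=> x; apply: cvgD; last exact: cg.
by apply: cvgZr; exact: cf.
Qed.

HB.instance Definition _ :=
  GRing.isSubmodClosed.Build _ _ dual_pred dual_submod_closed.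
HB.instance Definition _ := [SubChoice_isSubLmodule of dual by <:].

Lemma dual_linear (f : dual) : linear f.
Proof. by have := dualP f; rewrite inE => -[]. Qed.

Lemma dual_continuous (f : dual) : continuous f.
Proof. by have := dualP f; rewrite inE => -[]. Qed.

HB.instance Definition _ (f : dual) :=
  GRing.isLinear.Build R X R^o *:%R (dual_fun f) (dual_linear f).

Definition dual_norm (f : dual) : R :=
  sup_norm [set x : X | `|x| <= 1] f.

Lemma dual_bounded (f : dual) :
  exists M : R, forall x, [set x : X | `|x| <= 1] x -> `|f x| <= M.
Proof.
have : bounded_near (f : {linear X -> R^o}) (nbhs (0 : X)).
  by apply/linear_bounded_continuous; exact: dual_continuous.
move/linear_boundedP => /pinfty_ex_gt0 [r r0 fr].
exists r => x /= x1; rewrite (le_trans (fr x))//.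
by rewrite -[leRHS]mulr1 ler_wpM2l// ltW.
Qed.

Lemma dual_le (f : dual) x : `|f x| <= dual_norm f * `|x|.
Proof.
have [->|x0] := eqVneq x 0; first by rewrite linear0 !normr0 mulr0.
have [M fM] := dual_bounded f.
have nx : 0 < `|x| by rewrite normr_gt0.
rewrite -ler_pdivrMr//.
have -> : `|f x| / `|x| = `|f (`|x|^-1 *: x)|.
  by rewrite linearZ/= [in RHS]normrM normfV normr_id mulrC.
apply: (sup_norm_ge fM) => /=.
by rewrite normrZ normfV normr_id mulVf// gt_eqF.
Qed.

Lemma dual_normD (f g : dual) : dual_norm (f + g) <= dual_norm f + dual_norm g.
Proof.
have [M fM] := dual_bounded f; have [N gN] := dual_bounded g.
exact: sup_normD fM gN.
Qed.

Lemma dual_normZ (l : R) (f : dual) : dual_norm (l *: f) = `|l| * dual_norm f.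
Proof. by have [M fM] := dual_bounded f; exact: sup_normZ fM. Qed.

Lemma dual_norm0_eq0 (f : dual) : dual_norm f = 0 -> f = 0.
Proof.
move=> f0; apply/val_inj/funext => x /=.
by apply/eqP; rewrite -normr_le0 (le_trans (dual_le f x))// f0 mul0r.
Qed.

HB.instance Definition _ :=
  Lmodule_isNormed.Build R dual dual_normD dual_normZ dual_norm0_eq0.

(** Used as a type, it carries the subspace topology of the dual norm. *)
Definition dual_sphere : set dual := [set f | `|f| = 1].

End dual.
Arguments dual_sphere {R} X.

(** Bounded continuous real functions on a topological space, with the
    supremum norm. *)
Section bcfun.
Context (R : realType) (T : topologicalType).

Definition bcfun_pred : {pred T -> R^o} :=
  mem [set f : T -> R^o | continuous f /\ exists M : R, forall x, `|f x| <= M].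

Record bcfun := BCFun {
  bcfun_fun :> T -> R^o ;
  bcfunP : bcfun_fun \in bcfun_pred }.

HB.instance Definition _ := [isSub for bcfun_fun].
HB.instance Definition _ := [Choice of bcfun by <:].

Lemma bcfun_submod_closed : submod_closed bcfun_pred.
Proof.
split.
  rewrite inE; split=> [x|]; first exact: cst_continuous.
  by exists 0 => x; rewrite normr0.
move=> a f g; rewrite !inE => -[cf [M fM]] [cg [N gN]]; split.
  by move=> x; apply: cvgD; [apply: cvgZr; exact: cf|exact: cg].
exists (`|a| * M + N) => x.
rewrite (le_trans (ler_normD _ _))// lerD//.
by rewrite normrM ler_wpM2l.
Qed.

HB.instance Definition _ :=
  GRing.isSubmodClosed.Build _ _ bcfun_pred bcfun_submod_closed.
HB.instance Definition _ := [SubChoice_isSubLmodule of bcfun by <:].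

Lemma bcfun_bounded (f : bcfun) :
  exists M : R, forall x, [set: T] x -> `|f x| <= M.
Proof. by have := bcfunP f; rewrite inE => -[_ [M fM]]; exists M => x _. Qed.

Definition bcfun_norm (f : bcfun) : R := sup_norm [set: T] f.

Lemma bcfun_normD (f g : bcfun) :
  bcfun_norm (f + g) <= bcfun_norm f + bcfun_norm g.
Proof.
have [M fM] := bcfun_bounded f; have [N gN] := bcfun_bounded g.
exact: sup_normD fM gN.
Qed.

Lemma bcfun_normZ (l : R) (f : bcfun) :
  bcfun_norm (l *: f) = `|l| * bcfun_norm f.
Proof. by have [M fM] := bcfun_bounded f; exact: sup_normZ fM. Qed.

Lemma bcfun_norm0_eq0 (f : bcfun) : bcfun_norm f = 0 -> f = 0.
Proof.
have [M fM] := bcfun_bounded f.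
move=> f0; apply/val_inj/funext => x /=; apply/eqP; rewrite -normr_le0 -f0.
exact: sup_norm_ge fM _.
Qed.

HB.instance Definition _ :=
  Lmodule_isNormed.Build R bcfun bcfun_normD bcfun_normZ bcfun_norm0_eq0.

End bcfun.
Arguments bcfun_pred : clear implicits.

Section convex_bounded_sets.
Local Open Scope convex_scope.
Context (R : realType) (X : normedModType R).

(** Elements are representatives: the mathematical BC(X) identifies [A] and [B]
    when [rho_H A B = 0]. All notions below ([radstrom], [setnorm], [rho_H],
    [BCadd], [BCscale]) are compatible with this identification. *)
Record BC := MkBC {
  BCset :> set X ;
  BC_nonempty : BCset !=set0 ;
  BC_bounded : bounded_set BCset ;
  BC_convex : convex_set (BCset : set (convex_lmodType X)) }.

Lemma BC_boundP (A : BC) :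
  exists2 M : R, 0 <= M & forall a, BCset A a -> `|a| <= M.
Proof.
by have /pinfty_ex_gt0[M M0 AM] := BC_bounded A; exists M; [exact: ltW|].
Qed.

Lemma ex_bounded_set (A : set X) (M : R) :
  (forall a, A a -> `|a| <= M) -> bounded_set A.
Proof.
move=> AM; rewrite /bounded_set /bounded_near.
by near=> N => a Aa /=; rewrite (le_trans (AM _ Aa)).
Unshelve. all: by end_near. Qed.

Definition setnorm (A : set X) : R := sup [set `|a| | a in A].

Definition minkowski_add (A B : set X) : set X :=
  [set a + b | a in A & b in B].

Definition set_scale (t : R) (A : set X) : set X := [set t *: a | a in A].

Lemma convXE (l : {i01 R}) (a b : convex_lmodType X) :
  a <| l |> b = l%:num *: (a : X) + (1 - l%:num) *: (b : X) :> X.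
Proof. by []. Qed.

Fact minkowski_add_nonempty (A B : BC) : minkowski_add A B !=set0.
Proof.
have [a Aa] := BC_nonempty A; have [b Bb] := BC_nonempty B.
by exists (a + b), a => //; exists b.
Qed.

Fact minkowski_add_bounded (A B : BC) : bounded_set (minkowski_add A B).
Proof.
have [M _ AM] := BC_boundP A; have [N _ BN] := BC_boundP B.
apply: (@ex_bounded_set _ (M + N)) => _ [a Aa] [b Bb] <-.
by rewrite (le_trans (ler_normD _ _))// lerD// ?AM ?BN.
Qed.

Fact minkowski_add_convex (A B : BC) :
  convex_set (minkowski_add A B : set (convex_lmodType X)).
Proof.
move=> _ _ l /set_mem[a Aa] [b Bb] <- /set_mem[c Ac] [d Bd] <-.
apply/mem_set; exists ((a : convex_lmodType X) <| l |> c).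
  by apply/set_mem; apply: BC_convex; exact/mem_set.
exists ((b : convex_lmodType X) <| l |> d).
  by apply/set_mem; apply: BC_convex; exact/mem_set.
by rewrite !convXE !scalerDr addrACA.
Qed.

Definition BCadd (A B : BC) : BC :=
  MkBC (minkowski_add_nonempty A B) (minkowski_add_bounded A B)
       (@minkowski_add_convex A B).

Fact set_scale_nonempty t (A : BC) : set_scale t A !=set0.
Proof. by have [a Aa] := BC_nonempty A; exists (t *: a), a. Qed.

Fact set_scale_bounded t (A : BC) : bounded_set (set_scale t A).
Proof.
have [M _ AM] := BC_boundP A.
apply: (@ex_bounded_set _ (`|t| * M)) => _ [a Aa] <-.
by rewrite normrZ ler_wpM2l// AM.
Qed.

Fact set_scale_convex t (A : BC) :
  convex_set (set_scale t A : set (convex_lmodType X)).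
Proof.
move=> _ _ l /set_mem[a Aa] <- /set_mem[b Ab] <-.
apply/mem_set; exists ((a : convex_lmodType X) <| l |> b).
  by apply/set_mem; apply: BC_convex; exact/mem_set.
by rewrite !convXE scalerDr !scalerA mulrC [X in _ + X *: _]mulrC.
Qed.

Definition BCscale (t : R) (A : BC) : BC :=
  MkBC (set_scale_nonempty t A) (set_scale_bounded t A)
       (@set_scale_convex t A).

Fact BC0_bounded : bounded_set [set (0 : X)].
Proof. by apply: (@ex_bounded_set _ 0) => _ ->; rewrite normr0. Qed.

Fact BC0_convex : convex_set ([set 0] : set (convex_lmodType X)).
Proof.
move=> _ _ l /set_mem-> /set_mem->; apply/mem_set.
by rewrite /= convXE !scaler0 addr0.
Qed.

Definition BC0 : BC := MkBC (ex_intro _ 0 erefl) BC0_bounded BC0_convex.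

Definition rho_H (A B : BC) : R :=
  Num.max (sup [set inf [set `|a - b| | a in BCset A] | b in BCset B])
          (sup [set inf [set `|a - b| | b in BCset B] | a in BCset A]).

Definition Zspace := bcfun R (dual_sphere X).

Definition support_fun (A : set X) (f : dual_sphere X) : R^o :=
  sup [set (\val f : dual X) a | a in A].

Lemma support_fun_lip (A : BC) (M : R) (f g : dual_sphere X) :
  (forall a, BCset A a -> `|a| <= M) ->
  support_fun A f <= support_fun A g + `|\val f - \val g| * M.
Proof.
move=> AM; apply: ge_sup.
  by have [a Aa] := BC_nonempty A; exists ((\val f : dual X) a), a.
move=> _ [a Aa <-].
have -> : (\val f : dual X) a =
    (\val g : dual X) a + (\val f - \val g : dual X) a.
  by rewrite [(_ - _ : dual X) a]/= addrC subrK.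
apply: lerD.
  apply: ub_le_sup; last by exists a.
  exists M => _ [b Ab <-]; apply: le_trans (ler_norm _) _.
  apply: le_trans (dual_le _ _) _.
  have -> : dual_norm (\val g) = 1 by exact: (set_valP g).
  by rewrite mul1r AM.
apply: le_trans (ler_norm _) _; apply: le_trans (dual_le _ _) _.
by rewrite ler_wpM2l ?AM//; exact: sup_norm_ge0.
Qed.

Fact support_fun_bcfun (A : BC) :
  support_fun A \in bcfun_pred R (dual_sphere X).
Proof.
have [M M0 AM] := BC_boundP A; rewrite inE; split.
  move=> f; apply/(@cvgrPdist_le _ _ _ (nbhs f) (@nbhs_pfilter _ f)) => e e0.
  have e1 : 0 < e / (M + 1) by rewrite divr_gt0// ltr_wpDl.
  have cf : continuous (\val : dual_sphere X -> dual X).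
    exact: initial_continuous.
  have fB : nbhs (\val f : dual X) [set h | `|\val f - h| <= e / (M + 1)].
    have /cvgrPdist_le := @cvg_id _ (nbhs (\val f : dual X)).
    by apply.
  apply: (@filterS _ _ (@nbhs_pfilter _ f) _ _ _ (cf f _ fB)) => g /= fg.
  have h : `|\val f - \val g : dual X| * M <= e.
    rewrite (le_trans (ler_wpM2r M0 fg))// -mulrA ger_pMr//.
    by rewrite ler_pdivrMl ?ltr_wpDl// mulr1 lerDl.
  rewrite ler_norml; apply/andP; split.
    rewrite lerNl opprB lerBlDl (le_trans (support_fun_lip g f AM))//.
    by rewrite lerD2l distrC.
  by rewrite lerBlDl (le_trans (support_fun_lip f g AM))// lerD2l.
exists M => f.
have fM a : BCset A a -> `|(\val f : dual X) a| <= M.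
  move=> Aa; apply: le_trans (dual_le _ _) _.
  have -> : dual_norm (\val f) = 1 by exact: (set_valP f).
  by rewrite mul1r AM.
rewrite ler_norml; apply/andP; split.
  have [a Aa] := BC_nonempty A.
  apply: (@le_trans _ _ ((\val f : dual X) a)).
    by have := fM _ Aa; rewrite ler_norml => /andP[].
  apply: ub_le_sup; last by exists a.
  by exists M => _ [b Ab <-]; exact: le_trans (ler_norm _) (fM _ Ab).
apply: ge_sup.
  by have [a Aa] := BC_nonempty A; exists ((\val f : dual X) a), a.
by move=> _ [b Ab <-]; exact: le_trans (ler_norm _) (fM _ Ab).
Qed.

Definition radstrom (A : BC) : Zspace := BCFun (support_fun_bcfun A).

Definition B_convex :=
  exists n : nat, (2 <= n)%N /\ exists eps : R, 0 < eps /\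
    forall x : 'I_n -> X, (forall i, `|x i| <= 1) ->
      exists s : 'I_n -> bool,
        `|\sum_(i < n) (-1) ^+ s i *: x i| <= (1 - eps) * n%:R.

Definition lin_span (A : set X) : set X :=
  [set x | exists n (a : 'I_n -> X) (c : 'I_n -> R),
      (forall i, A (a i)) /\ x = \sum_(i < n) c i *: a i].

Definition finite_dimensional (L : set X) :=
  exists n (e : 'I_n -> X), L = lin_span (range e).

End convex_bounded_sets.

Section bochner.
Context (R : realType) d (T : measurableType d)
  (P : probability T R) (V : normedModType R).

Definition simple_function (s : T -> V) :=
  finite_set (range s) /\ forall v, measurable (s @^-1` [set v]).

(* The sum runs over the finite range of [s], the other terms being null. *)
Definition simple_integral (s : T -> V) : V :=
  \sum_(v \in [set: V]) fine (P (s @^-1` [set v])) *: v.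

(** [F] is Bochner integrable with integral [v]. *)
Definition bochner_integral_is (F : T -> V) (v : V) :=
  exists s : nat -> T -> V,
    [/\ forall n, simple_function (s n),
        {ae P, forall w, s n w @[n --> \oo] --> F w},
        (\int[P]_w (`|F w - s n w|)%:E)%E @[n --> \oo] --> 0%E &
        simple_integral (s n) @[n --> \oo] --> v].

End bochner.

Section independence.
Context (R : realType) d (T : measurableType d) (P : probability T R)
  (V : topologicalType).

Definition borel_set (B : set V) := <<s @open V >> B.

Definition independent_random_vectors (X : nat -> T -> V) :=
  forall (J : {fset nat}) (B : nat -> set V),
    (forall j, j \in J -> borel_set (B j)) ->
    P (\bigcap_(j in [set` J]) (X j @^-1` B j)) =
    (\prod_(j <- J) P (X j @^-1` B j))%E.

End independence.

Section random_sets.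
Context (R : realType) (X : normedModType R) d (T : measurableType d).

Definition random_set (F : T -> BC X) :=
  forall G : set (Zspace X), open G ->
    measurable ((@radstrom R X \o F) @^-1` G).

Definition expectation_is (P : probability T R) (F : T -> BC X) (A : BC X) :=
  bochner_integral_is P (@radstrom R X \o F) (radstrom A).

Definition independent_random_sets (P : probability T R)
    (F : nat -> T -> BC X) :=
  independent_random_vectors P (fun n => @radstrom R X \o F n).

Definition uniformly_bounded (F : nat -> T -> BC X) :=
  has_ubound [set setnorm (F n w) | n in [set: nat] & w in [set: T]].

End random_sets.

(* Main.v *)
Require Import Defs.
From HB Require Import structures.
From mathcomp Require Import all_boot all_order all_algebra finmap.
From mathcomp Require Import all_classical all_reals all_analysis.
From mathcomp Require Import measurable_realfun.
From mathcomp Require Import ring lra.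

Set Implicit Arguments.
Unset Strict Implicit.
Unset Printing Implicit Defensive.

Import Order.TTheory GRing.Theory Num.Theory.
Import numFieldNormedType.Exports.

Local Open Scope classical_set_scope.
Local Open Scope ring_scope.

(** Let [L] be the closed linear span of [U], a finite-dimensional space, and
    write [h A] for the support function [radstrom A] of a convex set [A].

    If a functional [f] vanishes on [L], the width [h (Psi w) f + h (Psi w) (- f)]
    of one of the random sets is nonnegative, and its mean is the width of [U],
    which is zero. So it vanishes almost surely; as a Bochner integrable map is
    essentially separably valued, the exceptional event can be chosen
    independently of [f], and almost surely [Psi w] lies in a translate of [L]
    ([ae_diff_in_subspace]). Choose a point [x] in each value of [Psi]. Then
    [h Psi f - h U f] is the sum of [f (x - E x)] and of a centred real variable
    that depends on [f] only through its restriction to [L] ([decomposition]).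

    The averages of the first term are small uniformly in [f] by the strong law
    of large numbers for vectors of [X]. Those of the second one are small at
    any finite number of functionals by the same law on the real line, and
    finitely many functionals suffice, because bounded subsets of [L] are totally
    bounded ([dual_sphere_net]). Uniform convergence of support functions is
    convergence for the Hausdorff distance, by the separation of convex sets
    ([rho_H_le_radstrom]), which rests on the Hahn-Banach theorem.

    The law for vectors ([label_slln]) is due to Beck. B-convexity improves the
    Cauchy-Schwarz bound on the second moment of a Rademacher sum of [n] vectors
    by a factor [b < 1] ([rad_bound_base]), hence by [b ^ j] for [n ^ j] vectors
    ([rad_bound_ipow]). Inserting signs in a sum of independent centred vectors
    costs a factor [4] ([pmean_signs]), so blocks of length [n ^ j] deviate with
    a probability that is geometrically small in [j]. The Borel-Cantelli lemma
    and an interpolation between blocks ([block_interpolation]) conclude.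

    The random sets are first replaced by finitely valued ones
    ([discretization]): the law of a block of them is a finite product law, and
    its moments are finite sums. *)

(** * Sublinear functionals and the separation of convex sets *)

Section sublinear.
Context (R : realType) (V : lmodType R).
Implicit Types (q p : V -> R) (C : set V).

Definition sublinear q :=
  (forall x y, q (x + y) <= q x + q y) /\
  (forall t x, 0 <= t -> q (t *: x) = t * q x).

Lemma sublinearW q :
  (forall x y, q (x + y) <= q x + q y) -> q 0 = 0 ->
  (forall t x, 0 < t -> q (t *: x) <= t * q x) -> sublinear q.
Proof.
move=> qD q0 qZ; split=> // t x; rewrite le_eqVlt => /predU1P[<-|t0].
  by rewrite scale0r q0 mul0r.
apply/eqP; rewrite eq_le qZ//= -ler_pdivlMl//.
rewrite (le_trans _ (qZ _ _ _)) ?invr_gt0//.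
by rewrite scalerA mulVf ?gt_eqF// scale1r.
Qed.

Lemma sublinear0 q : sublinear q -> q 0 = 0.
Proof. by move=> [_ qZ]; rewrite -[X in q X](scale0r 0) qZ// mul0r. Qed.

Lemma sublinear_ge q x : sublinear q -> - q (- x) <= q x.
Proof.
move=> sq; rewrite -subr_ge0 opprK.
by have [qD _] := sq; have := qD x (- x); rewrite subrr (sublinear0 sq).
Qed.

Definition cone_convex C := forall s t c d, 0 <= s -> 0 <= t -> C c -> C d ->
  exists2 e, C e & s *: c + t *: d = (s + t) *: e.

Lemma cone_convex1 (y : V) : cone_convex [set y].
Proof. by move=> s t _ _ _ _ -> ->; exists y => //; rewrite scalerDl. Qed.

(** When [q >= r] on the convex set [C], this is the largest sublinear
    functional below [q] that is at most [- r] on [- C]. *)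
Definition lowering q C (r : R) (x : V) : R :=
  inf [set y | exists t c, [/\ 0 <= t, C c & y = q (x + t *: c) - t * r]].

Lemma loweringP q C r : sublinear q -> cone_convex C -> C !=set0 ->
  (forall c, C c -> r <= q c) ->
  [/\ sublinear (lowering q C r), forall x, lowering q C r x <= q x &
      forall c, C c -> lowering q C r (- c) <= - r].
Proof.
move=> sq cC [c0 Cc0] Cr; have [qD qZ] := sq.
pose S x := [set y | exists t c, [/\ 0 <= t, C c & y = q (x + t *: c) - t * r]].
have S0 x : S x !=set0.
  by exists (q (x + 0 *: c0) - 0 * r), 0, c0.
have lbS x : lbound (S x) (- q (- x)).
  move=> _ [t [c [t0 Cc ->]]].
  have : q (t *: c) <= q (x + t *: c) + q (- x).
    by rewrite (le_trans _ (qD _ _))// addrAC subrr add0r.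
  rewrite qZ// => h; have := ler_wpM2l t0 (Cr c Cc); lra.
have Slb x : has_lbound (S x) by exists (- q (- x)); exact: lbS.
have leS x t c : 0 <= t -> C c -> lowering q C r x <= q (x + t *: c) - t * r.
  by move=> t0 Cc; apply: (ge_inf (Slb x)); exists t, c.
have lowE x : lowering q C r x = inf (S x) by [].
split.
- apply: sublinearW.
  + move=> x y; rewrite -lerBlDr [leRHS]lowE; apply: lb_le_inf => // u [s [c [s0 Cc ->]]].
    rewrite lerBlDr -lerBlDl [leRHS]lowE; apply: lb_le_inf => // v [t [d [t0 Cd ->]]].
    rewrite lerBlDl; have [e Ce sctd] := cC s t c d s0 t0 Cc Cd.
    rewrite (le_trans (leS _ (s + t) e _ _)) ?addr_ge0//.
    rewrite -sctd addrACA; have := qD (x + s *: c) (y + t *: d); lra.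
  + apply/eqP; rewrite eq_le; apply/andP; split.
      by rewrite (le_trans (leS 0 0 c0 _ _))// scale0r addr0 mul0r (sublinear0 sq) subr0.
    by rewrite lowE; apply: lb_le_inf => // u /lbS; rewrite oppr0 (sublinear0 sq) oppr0.
  + move=> t x t0; rewrite -ler_pdivrMl// [leRHS]lowE.
    apply: lb_le_inf => // _ [s [c [s0 Cc ->]]].
    rewrite ler_pdivrMl// (le_trans (leS _ (t * s) c _ _)) ?mulr_ge0 ?(ltW t0)//.
    by rewrite -scalerA -scalerDr qZ ?(ltW t0)// mulrBr mulrA.
- by move=> x; rewrite (le_trans (leS x 0 c0 _ _))// scale0r addr0 mul0r subr0.
- move=> c Cc; rewrite (le_trans (leS (- c) 1 c _ _))//.
  by rewrite scale1r addNr (sublinear0 sq) mul1r add0r.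
Qed.

(** A minimal sublinear functional is linear: lowering it at [y] by its own
    value at [y] does not change it, so it is superadditive. Zorn's lemma applies
    because the infimum of a chain of sublinear functionals is sublinear. *)
Lemma hahn_banach q0 : sublinear q0 ->
  exists2 f : V -> R, linear (f : V -> R^o) & forall x, f x <= q0 x.
Proof.
move=> sq0.
pose T := {q : V -> R | sublinear q /\ forall x, q x <= q0 x}.
pose rel (q p : T) := `[< forall x, sval p x <= sval q x >].
have := @Zorn T rel; case.
- by move=> q; apply/asboolP.
- move=> a b c /asboolP ab /asboolP bc; apply/asboolP => x.
  exact: le_trans (bc x) (ab x).
- move=> [a ha] [b hb] /asboolP/= ab /asboolP/= ba; apply: eq_exist.
  by apply/funext => x; apply/eqP; rewrite eq_le ab ba.
- move=> A totA; have [->|/set0P[a0 Aa0]] := eqVneq A set0.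
    by exists (exist _ q0 (conj sq0 (fun=> lexx _))).
  pose S x := [set sval a x | a in A].
  have S0 x : S x !=set0 by exists (sval a0 x), a0.
  have Slb x : has_lbound (S x).
    exists (- q0 (- x)) => _ [[a [sa aq]] _ <-] /=.
    by rewrite (le_trans _ (sublinear_ge x sa))// lerN2.
  have leS x a : A a -> inf (S x) <= sval a x.
    by move=> Aa; apply: ge_inf => //; exists a.
  suff h : sublinear (fun x => inf (S x)) /\ forall x, inf (S x) <= q0 x.
    by exists (exist _ (fun x => inf (S x)) h : T) => a Aa; apply/asboolP => x /=; exact: leS.
  split; last first.
    by move=> x; rewrite (le_trans (leS x _ Aa0))//; case: (svalP a0).
  apply: sublinearW.
  + move=> x y; rewrite -lerBlDr; apply: lb_le_inf => // _ [a Aa <-].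
    rewrite lerBlDr -lerBlDl; apply: lb_le_inf => // _ [b Ab <-].
    rewrite lerBlDl.
    have [/asboolP ab|/asboolP ba] := totA _ _ Aa Ab.
      rewrite (le_trans (leS _ _ Ab))//; have [[bD _] _] := svalP b.
      by rewrite (le_trans (bD _ _))// lerD.
    rewrite (le_trans (leS _ _ Aa))//; have [[aD _] _] := svalP a.
    by rewrite (le_trans (aD _ _))// lerD.
  + rewrite (_ : S 0 = [set 0]) ?inf1//; apply/seteqP; split.
      by move=> _ [a _ <-]; have [sa _] := svalP a; rewrite /= (sublinear0 sa).
    by move=> _ ->; exists a0 => //; have [sa _] := svalP a0; exact: sublinear0.
  + move=> t x t0; rewrite -ler_pdivrMl//; apply: lb_le_inf => // _ [a Aa <-].
    rewrite ler_pdivrMl//; have [[_ aZ] _] := svalP a.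
    by rewrite -aZ ?(ltW t0)//; exact: leS.
- move=> [f [sf fq]] fmin; exists f => //.
  have [fD fZ] := sf.
  have fDge x y : f x + f y <= f (x + y).
    have [|c ->|sl ll ly] := @loweringP f [set y] (f y) sf (@cone_convex1 y).
    - by exists y.
    - exact: lexx.
    have hl : sublinear (lowering f [set y] (f y)) /\
        forall x, lowering f [set y] (f y) x <= q0 x.
      by split=> // z; exact: le_trans (ll z) (fq z).
    have /(congr1 sval)/= fl : (exist _ (lowering f [set y] (f y)) hl : T) = exist _ f (conj sf fq).
      by apply: fmin; apply/asboolP.
    have := ly y erefl; rewrite fl => fNy.
    by have := fD (x + y) (- y); rewrite addrK; lra.
  have fDE x y : f (x + y) = f x + f y.
    by apply/eqP; rewrite eq_le fD fDge.
  have fN x : f (- x) = - f x.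
    by apply/eqP; rewrite -subr_eq0 opprK -fDE addNr sublinear0.
  move=> t x y; rewrite fDE; congr (_ + _).
  have [t0|t0] := leP 0 t; first by rewrite fZ.
  rewrite -[t in LHS]opprK scaleNr fN fZ ?oppr_ge0 ?ltW//.
  by rewrite mulNr opprK.
Qed.

End sublinear.

Section separation.
Context (R : realType) (X : normedModType R).
Implicit Types (A B : BC X).

Lemma sublinear_norm : sublinear (fun x : X => `|x| : R).
Proof.
split=> [x y|t x t0]; first exact: ler_normD.
by rewrite normrZ ger0_norm.
Qed.

(** Lower the norm by [r] along [- C]: a linear functional below the result has
    norm at most one and is at least [r] on [C], and normalizing it only
    increases its values on [C]. *)
Lemma separation (C : set X) (r : R) : 0 < r -> cone_convex C -> C !=set0 ->
  (forall c, C c -> r <= `|c|) ->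
  exists f : dual_sphere X, forall c, C c -> r <= (\val f : dual X) c.
Proof.
move=> r0 cC C0 Cr.
have [sl ln lC] := loweringP sublinear_norm cC C0 Cr.
have [f lf fl] := hahn_banach sl.
have fn x : f x <= `|x| by rewrite (le_trans (fl x)).
pose F := GRing.isLinear.Build R X R^o *:%R f lf.
pose g : {linear X -> R^o} := HB.pack f F.
have fN x : f (- x) = - f x by exact: (linearN g).
have fnorm x : `|f x| <= `|x|.
  by rewrite ler_norml fn andbT lerNl -fN -[leRHS]normrN fn.
have cf : continuous (f : X -> R^o).
  apply: (@linear_bounded_continuous _ _ _ g).1.
  apply/linear_boundedP; near=> M => x.
  rewrite (le_trans (fnorm x))// ler_peMl//.
Unshelve. all: try by end_near.
have fd : (f : X -> R^o) \in @dual_pred R X by rewrite inE.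
pose d := Dual fd.
have dC c : C c -> r <= d c.
  by move=> Cc; rewrite -lerN2 -fN (le_trans (fl _))// lC.
have dn1 : `|d| <= 1.
  apply: sup_norm_le => // x /= x1; exact: le_trans (fnorm x) x1.
have [c0 Cc0] := C0.
have dn0 : 0 < `|d|.
  rewrite normr_gt0; apply/eqP => d0.
  by have := dC c0 Cc0; rewrite d0 leNgt /= r0.
have ds : dual_sphere X (`|d|^-1 *: d).
  by rewrite /dual_sphere/= normrZ normfV normr_id mulVf// gt_eqF.
exists (SigSub (mem_set ds)) => c Cc /=.
rewrite [leRHS](_ : _ = `|d|^-1 * d c)//.
rewrite (le_trans (dC c Cc))// ler_peMl//.
  by rewrite (le_trans (ltW r0))// dC.
by rewrite invf_ge1.
Qed.
End separation.

(** * Hausdorff distance and support functions *)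

Section rho_H_radstrom.
Context (R : realType) (X : normedModType R).
Implicit Types (A B : BC X).

Lemma BC_cone_convex A : cone_convex (A : set X).
Proof.
move=> s t c d s0 t0 Ac Ad.
have [st|st] := eqVneq (s + t) 0.
  exists c => //; have s0' : s = 0 by lra.
  by have -> : t = 0; [lra|rewrite s0' addr0 !scale0r addr0].
have st0 : 0 < s + t by rewrite lt_neqAle eq_sym st addr_ge0.
have l0 : 0 <= s / (s + t) by rewrite divr_ge0// ltW.
have l1 : s / (s + t) <= 1 by rewrite ler_pdivrMr// mul1r lerDl.
have := @BC_convex _ _ A c d (Itv01 l0 l1) (mem_set Ac) (mem_set Ad).
move/set_mem; rewrite convXE /=; set e := (X in _ X) => Ae; exists e => //.
have sE : (s + t) * (s / (s + t)) = s by rewrite mulrC divfK.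
by rewrite /e scalerDr !scalerA mulrBr mulr1 sE [s + t]addrC addrK.
Qed.

Lemma radstromE A (f : dual_sphere X) :
  radstrom A f = sup [set (\val f : dual X) a | a in A].
Proof. by []. Qed.

Lemma sphere_le (f : dual_sphere X) (x : X) : `|(\val f : dual X) x| <= `|x|.
Proof.
apply: le_trans (dual_le _ _) _.
have -> : dual_norm (\val f) = 1 by exact: (set_valP f).
by rewrite mul1r.
Qed.

Lemma support_has_sup A (f : dual_sphere X) :
  has_sup [set (\val f : dual X) a | a in A].
Proof.
have [a Aa] := BC_nonempty A; split; first by exists ((\val f : dual X) a), a.
have [M _ AM] := BC_boundP A; exists M => _ [b Ab <-].
exact: le_trans (ler_norm _) (le_trans (sphere_le f b) (AM b Ab)).
Qed.

Lemma radstrom_ge A (f : dual_sphere X) a :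
  (A : set X) a -> (\val f : dual X) a <= radstrom A f.
Proof.
by move=> Aa; apply: (ub_le_sup (support_has_sup A f).2); exists a.
Qed.

Lemma radstrom_le A (f : dual_sphere X) (r : R) :
  (forall a, (A : set X) a -> (\val f : dual X) a <= r) -> radstrom A f <= r.
Proof.
move=> Ar; apply: ge_sup; first exact: (support_has_sup A f).1.
by move=> _ [a Aa <-]; exact: Ar.
Qed.

Lemma radstrom_abs_le A (f : dual_sphere X) (r : R) :
  (forall a, (A : set X) a -> `|a| <= r) -> `|radstrom A f| <= r.
Proof.
move=> Ar.
have h a : (A : set X) a -> `|(\val f : dual X) a| <= r.
  by move=> Aa; exact: le_trans (sphere_le f a) (Ar a Aa).
rewrite ler_norml; apply/andP; split; last first.
  by apply: radstrom_le => a Aa; exact: le_trans (ler_norm _) (h a Aa).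
have [a Aa] := BC_nonempty A; rewrite (le_trans _ (radstrom_ge f Aa))//.
by have := h a Aa; rewrite ler_norml => /andP[].
Qed.

Lemma bcfun_le_norm (T : topologicalType) (z : bcfun R T) (f : T) : `|z f| <= `|z|.
Proof.
by have [M zM] := bcfun_bounded z; exact: sup_norm_ge zM _.
Qed.

Lemma bcfun_norm_le (T : topologicalType) (z : bcfun R T) (r : R) :
  0 <= r -> (forall f, `|z f| <= r) -> `|z| <= r.
Proof. by move=> r0 zr; apply: sup_norm_le => // f _; exact: zr. Qed.

(** If [b] were further than [r] from [A], a functional of norm one separating
    [b - A] from the origin would show a gap larger than [r] between the support
    functions. *)
Lemma excess_le A B (r : R) (b : X) : (B : set X) b ->
  (forall f, radstrom B f - radstrom A f <= r) -> 0 <= r ->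
  inf [set `|a - b| | a in (A : set X)] <= r.
Proof.
move=> Bb ABr r0; rewrite leNgt; apply/negP => rinf.
set m := inf _ in rinf.
have [a0 Aa0] := BC_nonempty A.
have mle a : (A : set X) a -> m <= `|b - a|.
  move=> Aa; rewrite distrC; apply: ge_inf; last by exists a.
  by exists 0 => _ [? _ <-].
have [] := @separation _ _ [set b - a | a in (A : set X)] m.
- exact: le_lt_trans r0 rinf.
- move=> s t _ _ s0 t0 [a Aa <-] [a' Aa' <-].
  have [e Ae E] := BC_cone_convex s0 t0 Aa Aa'.
  exists (b - e); first by exists e.
  by rewrite !scalerBr -E scalerDl opprD addrACA.
- by exists (b - a0), a0.
- by move=> _ [a Aa <-]; exact: mle.
move=> f fm; have := ABr f; rewrite leNgt => /negP; apply.
rewrite (lt_le_trans rinf)// lerBrDl -lerBrDr; apply: radstrom_le => a Aa.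
have := radstrom_ge f Bb; have := fm (b - a) (ex_intro2 _ _ a Aa erefl).
by rewrite linearB/=; lra.
Qed.

Lemma rho_H_le_radstrom A B : rho_H A B <= `|radstrom A - radstrom B|.
Proof.
have AB f : `|radstrom A f - radstrom B f| <= `|radstrom A - radstrom B|.
  exact: (bcfun_le_norm (radstrom A - radstrom B) f).
rewrite ge_max; apply/andP; split.
- apply: ge_sup; first by have [b Bb] := BC_nonempty B; eexists; exists b.
  move=> _ [b Bb <-]; apply: excess_le Bb _ _ => // f.
  by rewrite (le_trans _ (AB f))// distrC ler_norm.
- apply: ge_sup; first by have [a Aa] := BC_nonempty A; eexists; exists a.
  move=> _ [a Aa <-].
  under eq_imagel do rewrite distrC.
  apply: excess_le Aa _ _ => // f.
  by rewrite (le_trans _ (AB f))// ler_norm.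
Qed.

Lemma radstromD A B f : radstrom (BCadd A B) f = radstrom A f + radstrom B f.
Proof.
apply/eqP; rewrite eq_le; apply/andP; split.
  apply: radstrom_le => _ [a Aa] [b Bb] <-.
  by rewrite linearD lerD// radstrom_ge.
rewrite -lerBrDr; apply: radstrom_le => a Aa.
rewrite lerBrDr -lerBrDl; apply: radstrom_le => b Bb.
rewrite lerBrDl -linearD; apply: radstrom_ge.
by exists a => //; exists b.
Qed.

Lemma radstrom0 f : radstrom (BC0 X) f = 0.
Proof. by rewrite radstromE /= image_set1 linear0 sup1. Qed.

Lemma radstromZ (t : R) A f : 0 < t ->
  radstrom (BCscale t A) f = t * radstrom A f.
Proof.
move=> t0; apply/eqP; rewrite eq_le; apply/andP; split.
  apply: radstrom_le => _ [a Aa <-].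
  by rewrite linearZ ler_pM2l// radstrom_ge.
rewrite -ler_pdivlMl//; apply: radstrom_le => a Aa.
rewrite ler_pdivlMl// [leLHS](_ : _ = (\val f : dual X) (t *: a)).
  by apply: radstrom_ge; exists a.
by rewrite linearZ.
Qed.

Lemma radstrom_mean (F : nat -> BC X) n f :
  radstrom (BCscale n.+1%:R^-1 (\big[@BCadd R X/BC0 X]_(i < n.+1) F i)) f =
  n.+1%:R^-1 * \sum_(i < n.+1) radstrom (F i) f.
Proof.
rewrite radstromZ ?invr_gt0//; congr (_ * _).
apply: (big_morph (fun A => radstrom A f)); first by move=> A B; exact: radstromD.
exact: radstrom0.
Qed.

End rho_H_radstrom.

(** * Rademacher averages in B-convex spaces *)

Section fmean.
Context (R : realType).
Implicit Types S : finType.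

(** The variance of [r] under the weights [w] is nonnegative. *)
Lemma sqr_wmean_le (S : finType) (w r : S -> R) :
  (forall s, 0 <= w s) -> \sum_s w s = 1 ->
  (\sum_s w s * r s) ^+ 2 <= \sum_s w s * r s ^+ 2.
Proof.
move=> w0 w1; set m := \sum_s w s * r s.
have : 0 <= \sum_s w s * (r s - m) ^+ 2.
  by apply: sumr_ge0 => s _; rewrite mulr_ge0// sqr_ge0.
have -> : \sum_s w s * (r s - m) ^+ 2 =
    \sum_s (w s * r s ^+ 2 - 2 * m * (w s * r s) + m ^+ 2 * w s).
  by apply: eq_bigr => s _; ring.
rewrite !big_split/= -mulr_sumr w1 sumrN -mulr_sumr -/m; nra.
Qed.

Definition fmean S (phi : S -> R) : R := #|S|%:R^-1 * \sum_s phi s.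

Lemma fmean_le S (phi psi : S -> R) :
  (forall s, phi s <= psi s) -> fmean phi <= fmean psi.
Proof. by move=> h; rewrite ler_wpM2l// ler_sum. Qed.

Lemma eq_fmean S (phi psi : S -> R) : phi =1 psi -> fmean phi = fmean psi.
Proof. by move=> h; rewrite /fmean (eq_bigr psi). Qed.

Lemma fmean_exchange (S T : finType) (phi : S -> T -> R) :
  fmean (fun s => fmean (phi s)) = fmean (fun t => fmean (phi^~ t)).
Proof.
by rewrite /fmean -!mulr_sumr exchange_big/= mulrCA.
Qed.

Lemma fmean_cst S (c : R) : (0 < #|S|)%N -> fmean (fun _ : S => c) = c.
Proof.
move=> S0; rewrite /fmean sumr_const -[c *+ _]mulr_natl mulrA mulVf ?mul1r//.
by rewrite pnatr_eq0 -lt0n.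
Qed.

Lemma fmeanZ S (c : R) (phi : S -> R) :
  fmean (fun s => c * phi s) = c * fmean phi.
Proof. by rewrite /fmean -mulr_sumr mulrCA. Qed.

Lemma fmean_sum (S T : finType) (phi : T -> S -> R) :
  fmean (fun s => \sum_t phi t s) = \sum_t fmean (phi t).
Proof. by rewrite /fmean exchange_big/= mulr_sumr. Qed.

Lemma fmean_reindex S (T : S -> S) (phi : S -> R) : injective T ->
  fmean phi = fmean (fun s => phi (T s)).
Proof. by move=> Ti; rewrite /fmean (reindex_inj Ti). Qed.

End fmean.

Section rademacher.
Context (R : realType) (X : normedModType R).

Definition signed_sum (I : finType) (x : I -> X) (s : {ffun I -> bool}) : X :=
  \sum_i (-1) ^+ s i *: x i.

(** The triangle and Cauchy-Schwarz inequalities give the bound with [b = 1];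
    a value [b < 1] measures a cancellation that holds in all of [X]. *)
Definition rad_bound (I : finType) (b : R) := forall x : I -> X,
  fmean (fun s => `|signed_sum x s| ^+ 2) <= b * #|I|%:R * \sum_i `|x i| ^+ 2.

Lemma norm_sign (b : bool) (x : X) : `|(-1) ^+ b *: x| = `|x|.
Proof. by rewrite normrZ normrX normrN1 expr1n mul1r. Qed.

Lemma signed_sum_le (I : finType) (x : I -> X) s :
  `|signed_sum x s| <= \sum_i `|x i|.
Proof.
rewrite (le_trans (ler_norm_sum _ _ _))//.
by apply: ler_sum => i _; rewrite norm_sign.
Qed.

Lemma card_ffun_bool (I : finType) : (0 < #|{ffun I -> bool}|)%N.
Proof. by apply/card_gt0P; exists [ffun=> false]. Qed.

(** Here [tau] and [M] are the mean and the maximum of [N] norms, and [S] the sum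
    of their squares. If [tau] is well below [M], the variance makes [S] large;
    otherwise the bound [(1 - e) * N * M] is a fraction of [N * tau]. *)
Let gap_numeric (N e tau M S v : R) : 1 <= N -> 0 < e -> e <= 1 ->
  0 <= tau -> tau <= M -> N * tau ^+ 2 + (M - tau) ^+ 2 <= S ->
  0 <= v -> v <= N * tau -> v <= (1 - e) * N * M ->
  v ^+ 2 <= (1 - e ^+ 2 / (8 * N)) * N * S.
Proof.
move=> N1 e0 e1 t0 tM hS v0 vt vM.
have N0 : 0 < N by rewrite (lt_le_trans _ N1).
set z := e ^+ 2 / (8 * N).
have zN : z * N = e ^+ 2 / 8 by rewrite /z; field; rewrite gt_eqF.
have z0 : 0 <= z by rewrite /z divr_ge0 ?sqr_ge0// mulr_ge0// ltW.
have z8 : z <= e / 8.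
  rewrite /z ler_pdivrMr ?mulr_gt0//; nra.
have z1 : 0 <= (1 - z) * N by rewrite mulr_ge0 ?ltW//; lra.
apply: le_trans (ler_wpM2l z1 hS).
have [tl|tg] := leP tau ((1 - e / 2) * M).
  have : v ^+ 2 <= (N * tau) ^+ 2 by rewrite ler_sqr ?nnegrE//; nra.
  move=> /le_trans; apply.
  have h : (e / 2 * tau) ^+ 2 <= (M - tau) ^+ 2.
    by rewrite ler_sqr ?nnegrE; nra.
  apply: le_trans (ler_wpM2l z1 (lerD (lexx _) h)).
  have -> : (1 - z) * N * (N * tau ^+ 2 + (e / 2 * tau) ^+ 2) =
    (N * tau) ^+ 2 + N * tau ^+ 2 * (e ^+ 2 / 4 - z * N - z * (e ^+ 2 / 4)) by field.
  rewrite lerDl mulr_ge0 ?mulr_ge0 ?sqr_ge0 ?(ltW N0)// zN.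
  have : z * (e ^+ 2 / 4) <= 1 / 8 * (e ^+ 2 / 4) by rewrite ler_wpM2r//; nra.
  nra.
have : v ^+ 2 <= ((1 - e) * N * M) ^+ 2 by rewrite ler_sqr ?nnegrE//; nra.
move=> /le_trans; apply.
have M0 : 0 <= M by rewrite (le_trans t0).
have h : ((1 - e / 2) * M) ^+ 2 <= tau ^+ 2.
  by rewrite ler_sqr ?nnegrE ?(ltW tg)// mulr_ge0//; lra.
have h2 : N * ((1 - e / 2) * M) ^+ 2 <= N * tau ^+ 2 + (M - tau) ^+ 2.
  by rewrite (le_trans (ler_wpM2l (ltW N0) h))// lerDl sqr_ge0.
apply: le_trans (ler_wpM2l z1 h2).
have -> : (1 - z) * N * (N * ((1 - e / 2) * M) ^+ 2) =
  ((1 - z) * (1 - e / 2) ^+ 2) * (N * M) ^+ 2 by ring.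
rewrite -mulrA exprMn ler_wpM2r ?sqr_ge0//.
have : (1 - e / 8) * (1 - e / 2) ^+ 2 <= (1 - z) * (1 - e / 2) ^+ 2.
  by rewrite ler_wpM2r ?sqr_ge0//; lra.
apply: le_trans; nra.
Qed.

(** Cauchy-Schwarz is strict unless all norms agree, and when they nearly agree
    B-convexity saves on at least one choice of signs. *)
Lemma rad_bound_base : B_convex X ->
  exists n, (1 < n)%N /\ exists b : R, [/\ 0 <= b, b < 1 & rad_bound 'I_n b].
Proof.
move=> [n [n2 [eps [eps0 Bc]]]]; exists n; split => //.
have n0 : (0 < n)%N by exact: ltnW.
pose e := Num.min eps 1.
have e0 : 0 < e by rewrite lt_min eps0 ltr01.
have e1 : e <= 1 by rewrite ge_min lexx orbT.
have ee : e <= eps by rewrite ge_min lexx.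
pose N : R := n%:R.
have N1 : 1 <= N by rewrite ler1n.
have N0 : 0 < N by rewrite (lt_le_trans _ N1).
pose k : R := #|{ffun 'I_n -> bool}|%:R.
have k1 : 1 <= k by rewrite ler1n card_ffun_bool.
have k0 : 0 < k by rewrite (lt_le_trans _ k1).
(* the relative gain of one of the [k] choices of signs *)
pose c := e ^+ 2 / (8 * N).
have c0 : 0 < c by rewrite divr_gt0 ?exprn_gt0// mulr_gt0.
have c1 : c <= 1 by rewrite ler_pdivrMr ?mulr_gt0//; nra.
exists (1 - c / k); split.
- by rewrite subr_ge0 ler_pdivrMr// mul1r (le_trans c1).
- by rewrite ltrBlDr ltrDl divr_gt0.
move=> x; rewrite card_ord -/N.
pose i0 : 'I_n := [arg max_(i > Ordinal n0) `|x i|]%O.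
have xi0 i : `|x i| <= `|x i0|.
  by rewrite /i0; case: Order.TotalTheory.arg_maxP => // j _; apply.
pose M := `|x i0|; pose T := \sum_i `|x i|; pose S := \sum_i `|x i| ^+ 2.
pose tau := T / N.
have T0 : 0 <= T by apply: sumr_ge0.
have NE : T = N * tau by rewrite /tau mulrC divfK// gt_eqF.
have tau0 : 0 <= tau by rewrite divr_ge0// ltW.
have tauM : tau <= M.
  rewrite ler_pdivrMr// (le_trans (ler_sum _ (fun i _ => xi0 i)))//.
  by rewrite sumr_const card_ord mulr_natr.
have varS : N * tau ^+ 2 + (M - tau) ^+ 2 <= S.
  have : (M - tau) ^+ 2 <= \sum_i (`|x i| - tau) ^+ 2.
    rewrite (bigD1 i0)//= lerDl sumr_ge0// => i _; exact: sqr_ge0.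
  under eq_bigr do rewrite sqrrB.
  rewrite !big_split/= sumrN sumrMnl -mulr_suml -/T -/S sumr_const card_ord.
  rewrite -[tau ^+ 2 *+ n]mulr_natl -/N NE; lra.
have vT s : `|signed_sum x s| <= N * tau by rewrite -NE; exact: signed_sum_le.
have S0 : 0 <= S by apply: sumr_ge0 => i _; exact: sqr_ge0.
have v1 s : `|signed_sum x s| ^+ 2 <= N * S.
  apply: (@le_trans _ _ ((N * tau) ^+ 2)).
    by rewrite ler_sqr ?nnegrE// mulr_ge0// ltW.
  rewrite exprMn expr2 -mulrA ler_wpM2l ?(ltW N0)// (le_trans _ varS)//.
  by rewrite lerDl sqr_ge0.
have [s0 hs0] : exists s0, `|signed_sum x s0| ^+ 2 <= (1 - c) * N * S.
  have [|s hs] := Bc (fun i => M^-1 *: x i).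
    move=> i; rewrite normrZ ger0_norm ?invr_ge0 ?normr_ge0//.
    have [M0|M0] := eqVneq M 0; first by rewrite M0 invr0 mul0r.
    by rewrite mulrC ler_pdivrMr ?mul1r ?xi0// lt_neqAle eq_sym M0 /M/=.
  exists [ffun i => s i]; apply: (gap_numeric (tau := tau) (M := M)) => //.
  have -> : signed_sum x [ffun i => s i] =
      M *: \sum_(i < n) (-1) ^+ s i *: (M^-1 *: x i).
    rewrite scaler_sumr; apply: eq_bigr => i _; rewrite ffunE scalerA mulrC -scalerA.
    congr (_ *: _); rewrite scalerA; have [M0|M0] := eqVneq M 0.
      by apply/eqP; rewrite M0 mul0r scale0r -normr_le0 (le_trans (xi0 i))// -/M M0.
    by rewrite divff// scale1r.
  rewrite normrZ ger0_norm /M// -/M mulrC ler_wpM2r ?normr_ge0//.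
  rewrite (le_trans hs)// ler_wpM2r//; lra.
rewrite /fmean -/k ler_pdivrMl//.
have : c * N * S <= \sum_s (N * S - `|signed_sum x s| ^+ 2).
  rewrite (bigD1 s0)//= (le_trans (_ : _ <= N * S - `|signed_sum x s0| ^+ 2))//.
    by rewrite lerBrDr -lerBrDl (le_trans hs0)//; lra.
  by rewrite lerDl sumr_ge0// => s _; rewrite subr_ge0.
rewrite big_split/= sumrN sumr_const -[_ *+ _]mulr_natl -/k.
have -> : k * ((1 - c / k) * N * S) = k * (N * S) - c * N * S.
  by field; rewrite gt_eqF.
by rewrite -/S; lra.
Qed.

Let sum_pair (V : nmodType) (I J : finType) (g : I * J -> V) :
  \sum_p g p = \sum_i \sum_j g (i, j).
Proof.
by rewrite (pair_bigA _ (fun i j => g (i, j)))/=; apply: eq_bigr; case.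
Qed.

(** Multiplying random signs on [I * J] by independent signs that depend on one
    coordinate only preserves their law. Signs on [I] give the bound on the sum
    of the rows, and then signs on [J] give it within each row. *)
Lemma rad_bound_prod (I J : finType) (b c : R) : 0 <= b ->
  rad_bound I b -> rad_bound J c -> rad_bound (I * J)%type (b * c).
Proof.
move=> b0 Ib Jc x.
pose flipI (t : {ffun I -> bool}) (s : {ffun I * J -> bool}) :=
  [ffun k => s k (+) t k.1].
pose flipJ (t : {ffun J -> bool}) (s : {ffun I * J -> bool}) :=
  [ffun k => s k (+) t k.2].
have flipI_inj t : injective (flipI t).
  by apply: inv_inj => s; apply/ffunP => k; rewrite !ffunE addbK.
have flipJ_inj t : injective (flipJ t).
  by apply: inv_inj => s; apply/ffunP => k; rewrite !ffunE addbK.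
have randI (phi : {ffun I * J -> bool} -> R) :
    fmean phi = fmean (fun s => fmean (fun t => phi (flipI t s))).
  rewrite fmean_exchange -[LHS](fmean_cst _ (card_ffun_bool I)).
  by apply: eq_fmean => t; exact: fmean_reindex.
have randJ (phi : {ffun I * J -> bool} -> R) :
    fmean phi = fmean (fun s => fmean (fun t => phi (flipJ t s))).
  rewrite fmean_exchange -[LHS](fmean_cst _ (card_ffun_bool J)).
  by apply: eq_fmean => t; exact: fmean_reindex.
pose row (s : {ffun I * J -> bool}) i := \sum_j (-1) ^+ s (i, j) *: x (i, j) : X.
have rowI s t : signed_sum x (flipI t s) = signed_sum (row s) t.
  rewrite /signed_sum sum_pair.
  apply: eq_bigr => i _; rewrite scaler_sumr; apply: eq_bigr => j _.
  by rewrite ffunE/= signr_addb scalerA mulrC.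
have rowJ s t i : row (flipJ t s) i =
    signed_sum (fun j => (-1) ^+ s (i, j) *: x (i, j)) t.
  apply: eq_bigr => j _.
  by rewrite ffunE/= signr_addb scalerA mulrC.
rewrite randI.
under eq_fmean do under eq_fmean do rewrite rowI.
apply: le_trans (fmean_le (fun s => Ib (row s))) _.
rewrite fmeanZ fmean_sum card_prod natrM.
rewrite [leRHS](_ : _ = b * #|I|%:R * (c * #|J|%:R * \sum_i `|x i| ^+ 2)); last by ring.
rewrite ler_wpM2l ?mulr_ge0//.
rewrite sum_pair mulr_sumr.
apply: ler_sum => i _; rewrite randJ.
under eq_fmean do under eq_fmean do rewrite rowJ.
apply: le_trans (fmean_le (fun s => Jc _)) _.
under eq_fmean do under eq_bigr do rewrite norm_sign.
by rewrite fmean_cst// card_ffun_bool.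
Qed.

(** Index types with [n ^ j] elements, as iterated products in order to apply
    [rad_bound_prod]. *)
Fixpoint ipow (n j : nat) : finType :=
  if j is j'.+1 then ('I_n * ipow n j')%type else unit.

Lemma card_ipow n j : #|ipow n j| = (n ^ j)%N.
Proof. by elim: j => [|j IH]/=; rewrite ?card_unit// card_prod IH card_ord expnS. Qed.

Lemma rad_bound_ipow n (b : R) j : 0 <= b -> rad_bound 'I_n b ->
  rad_bound (ipow n j) (b ^+ j).
Proof.
move=> b0 nb; elim: j => [|j IH] /=; last by rewrite exprS; exact: rad_bound_prod.
move=> x; rewrite expr0 card_unit mulr1 mul1r.
apply: le_trans (_ : fmean (fun s : {ffun unit -> bool} => \sum_i `|x i| ^+ 2) <= _).
  apply: fmean_le => s.
  rewrite /signed_sum (big_pred1 tt); last by case.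
  by rewrite norm_sign (big_pred1 tt)//; case.
by rewrite fmean_cst// card_ffun_bool.
Qed.

End rademacher.

(** * Decoupling under finite product laws *)

Section product_law.
Context (R : realType) (X : normedModType R) (I W : finType).
Variable p : I -> W -> R.
Hypothesis p0 : forall i w, 0 <= p i w.
Hypothesis p1 : forall i, \sum_w p i w = 1.

Definition pweight (f : {ffun I -> W}) : R := \prod_i p i (f i).

Definition pmean (phi : {ffun I -> W} -> R) : R := \sum_f pweight f * phi f.

Lemma pweight_ge0 f : 0 <= pweight f.
Proof. exact: prodr_ge0. Qed.

Lemma sum_pweight : \sum_f pweight f = 1.
Proof. by rewrite -bigA_distr_bigA big1. Qed.

Lemma pmean_le (phi psi : {ffun I -> W} -> R) :
  (forall f, phi f <= psi f) -> pmean phi <= pmean psi.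
Proof. by move=> h; apply: ler_sum => f _; rewrite ler_wpM2l// pweight_ge0. Qed.

Lemma pmean_cst c : pmean (fun=> c) = c.
Proof. by rewrite /pmean -mulr_suml sum_pweight mul1r. Qed.

Lemma pweight_marginal (i : I) (phi : W -> X) :
  \sum_f pweight f *: phi (f i) = \sum_w p i w *: phi w.
Proof.
have piw w : \sum_f pweight f * (f i == w)%:R = p i w.
  transitivity (\sum_(f : {ffun I -> W})
      \prod_j (p j (f j) * (if j == i then (f j == w)%:R else 1))).
    apply: eq_bigr => f _; rewrite big_split/=; congr (_ * _).
    by rewrite (bigD1 i)//= eqxx big1 ?mulr1// => j /negPf ->.
  rewrite -(bigA_distr_bigA (fun j v => p j v * (if j == i then (v == w)%:R else 1))).
  rewrite (bigD1 i)//= eqxx [X in _ * X]big1 ?mulr1.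
    rewrite (bigD1 w)//= eqxx mulr1 big1 ?addr0// => v /negPf ->.
    by rewrite mulr0.
  move=> j /negPf ->; rewrite -[RHS](p1 j); apply: eq_bigr => v _.
  by rewrite mulr1.
transitivity (\sum_f \sum_w (pweight f * (f i == w)%:R) *: phi w).
  apply: eq_bigr => f _; rewrite (bigD1 (f i))//= eqxx mulr1 big1 ?addr0// => w.
  by rewrite eq_sym => /negPf ->; rewrite mulr0 scale0r.
rewrite exchange_big/=; apply: eq_bigr => w _.
by rewrite -scaler_suml piw.
Qed.

Lemma jensen (y : {ffun I -> W} -> X) :
  `|\sum_g pweight g *: y g| ^+ 2 <= pmean (fun g => `|y g| ^+ 2).
Proof.
apply: le_trans (sqr_wmean_le _ _ sum_pweight); last exact: pweight_ge0.
rewrite ler_sqr ?nnegrE// ?sumr_ge0// => [|g _]; last first.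
  by rewrite mulr_ge0// pweight_ge0.
rewrite (le_trans (ler_norm_sum _ _ _))// ler_sum// => g _.
by rewrite normrZ ger0_norm// pweight_ge0.
Qed.

Let mix (A : pred I) (f g : {ffun I -> W}) : {ffun I -> W} :=
  [ffun i => if A i then f i else g i].

(** By convexity, adding independent centred terms can only increase the
    second moment; independence is used in the form that exchanging the
    coordinates outside [A] between two copies preserves the product law. *)
Lemma pmean_subset (A : pred I) (b : I -> W -> X) :
  (forall i, \sum_w p i w *: b i w = 0) ->
  pmean (fun f => `|\sum_(i | A i) b i (f i)| ^+ 2) <=
  pmean (fun f => `|\sum_i b i (f i)| ^+ 2).
Proof.
move=> b0; pose phi (f : {ffun I -> W}) := `|\sum_i b i (f i)| ^+ 2.
(* averaging out the coordinates outside [A] kills their centred terms *)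
have sumA (f : {ffun I -> W}) : \sum_(i | A i) b i (f i) =
    \sum_g pweight g *: \sum_i b i (mix A f g i).
  under [RHS]eq_bigr do rewrite scaler_sumr.
  rewrite exchange_big/= [RHS](bigID A)/= [X in _ = _ + X]big1 ?addr0.
    apply: eq_bigr => i Ai; under eq_bigr do rewrite ffunE Ai.
    by rewrite -scaler_suml sum_pweight scale1r.
  move=> i /negPf Ai; under eq_bigr do rewrite ffunE Ai.
  by rewrite pweight_marginal b0.
have h1 : pmean (fun f => `|\sum_(i | A i) b i (f i)| ^+ 2) <=
    pmean (fun f => pmean (fun g => phi (mix A f g))).
  by apply: pmean_le => f; rewrite sumA; exact: jensen.
apply: (le_trans h1); rewrite le_eqVlt; apply/orP; left; apply/eqP.
pose swap (u : {ffun I -> W} * {ffun I -> W}) := (mix A u.1 u.2, mix A u.2 u.1).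
have swapK : involutive swap.
  by move=> [f g]; congr (_, _); apply/ffunP => i; rewrite !ffunE/=; case: (A i).
have weight_swap u : pweight (swap u).1 * pweight (swap u).2 =
    pweight u.1 * pweight u.2.
  rewrite -!big_split/=; apply: eq_bigr => i _; rewrite !ffunE.
  by case: ifP => // _; rewrite mulrC.
transitivity (\sum_u pweight u.1 * pweight u.2 * phi (swap u).1).
  rewrite /pmean -(pair_bigA _ (fun f g => pweight f * pweight g * phi (mix A f g)))/=.
  apply: eq_bigr => f _; rewrite mulr_sumr; apply: eq_bigr => g _.
  by rewrite mulrA.
rewrite (reindex_inj (inv_inj swapK)).
under eq_bigr do rewrite swapK weight_swap.
rewrite -(pair_bigA _ (fun f g => pweight f * pweight g * phi f))/=.
apply: eq_bigr => f _; rewrite -mulr_suml -mulr_sumr sum_pweight mulr1//.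
Qed.

Lemma sqr_normD_le (u v : X) : `|u + v| ^+ 2 <= 2 * `|u| ^+ 2 + 2 * `|v| ^+ 2.
Proof.
have := ler_normD u v; rewrite -ler_sqr ?nnegrE ?addr_ge0//.
move=> /le_trans; apply; have := sqr_ge0 (`|u| - `|v|); nra.
Qed.

(** The terms with sign [+] and those with sign [-] form two partial sums of the
    signed sum, and each of them has a smaller second moment by [pmean_subset]. *)
Lemma pmean_signs (a : I -> W -> X) (s : {ffun I -> bool}) :
  (forall i, \sum_w p i w *: a i w = 0) ->
  pmean (fun f => `|\sum_i a i (f i)| ^+ 2) <=
  4 * pmean (fun f => `|signed_sum (fun i => a i (f i)) s| ^+ 2).
Proof.
move=> a0; pose b i w : X := (-1) ^+ s i *: a i w.
have b0 i : \sum_w p i w *: b i w = 0.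
  transitivity ((-1) ^+ s i *: \sum_w p i w *: a i w); last by rewrite a0 scaler0.
  by rewrite scaler_sumr; apply: eq_bigr => w _; rewrite !scalerA mulrC.
have h1 := pmean_subset (fun i => ~~ s i) b0.
have h2 := pmean_subset s b0.
have -> : 4 * pmean (fun f => `|signed_sum (fun i => a i (f i)) s| ^+ 2) =
  2 * pmean (fun f => `|\sum_i b i (f i)| ^+ 2) +
  2 * pmean (fun f => `|\sum_i b i (f i)| ^+ 2).
  by rewrite -mulrDl -natrD.
apply: le_trans (lerD (ler_wpM2l _ h1) (ler_wpM2l _ h2)) => //.
rewrite /pmean !mulr_sumr -big_split/=; apply: ler_sum => f _.
rewrite !(mulrCA 2 (pweight f)) -mulrDr ler_wpM2l ?pweight_ge0//.
have -> : \sum_i a i (f i) =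
    \sum_(i | ~~ s i) b i (f i) + - \sum_(i | s i) b i (f i).
  rewrite (bigID s)/= addrC -sumrN; congr (_ + _); apply: eq_bigr => i.
    by rewrite /b => /negPf ->; rewrite expr0 scale1r.
  by rewrite /b => ->; rewrite expr1 scaleN1r opprK.
by rewrite (le_trans (sqr_normD_le _ _))// normrN.
Qed.

(** [pmean_signs] holds for every choice of signs, hence on average. *)
Lemma pmean_rad (a : I -> W -> X) (b M : R) : 0 <= b -> rad_bound X I b ->
  (forall i, \sum_w p i w *: a i w = 0) -> (forall i w, `|a i w| <= M) ->
  pmean (fun f => `|\sum_i a i (f i)| ^+ 2) <= 4 * b * (#|I|%:R * M) ^+ 2.
Proof.
move=> b0 Ib a0 aM.
have sgn := card_ffun_bool I.
rewrite -[leLHS](fmean_cst _ sgn).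
apply: le_trans (fmean_le (fun s => pmean_signs s a0)) _.
rewrite fmeanZ -mulrA ler_wpM2l// /pmean fmean_sum.
under eq_bigr do rewrite fmeanZ.
rewrite -[leRHS]pmean_cst; apply: pmean_le => f.
apply: le_trans (Ib _) _; rewrite -mulrA ler_wpM2l// exprMn expr2 -mulrA.
rewrite ler_wpM2l//.
have -> : #|I|%:R * M ^+ 2 = \sum_(i : I) M ^+ 2 by rewrite sumr_const mulr_natl.
by apply: ler_sum => i _; rewrite ler_sqr ?nnegrE// (le_trans _ (aM i (f i))).
Qed.

End product_law.

(** * Finitely valued random variables *)

Section finite_labels.
Context (R : realType) d (Omega : measurableType d) (mu : probability Omega R).
Local Open Scope ereal_scope.

Lemma fiber_bigcup (W : finType) (h : Omega -> W) (A : pred W) :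
  [set w | A (h w)] = \bigcup_(i in [set i | A i]) (h @^-1` [set i]).
Proof.
by apply/seteqP; split=> [w Aw|w [i /= Ai hw]]; [exists (h w)|rewrite /= hw].
Qed.

Lemma measurable_fibers (W : finType) (h : Omega -> W) (A : pred W) :
  (forall i, measurable (h @^-1` [set i])) -> measurable [set w | A (h w)].
Proof.
move=> mh; rewrite fiber_bigcup; apply: fin_bigcup_measurable => //.

Qed.

Lemma probability_fibers (W : finType) (h : Omega -> W) (A : pred W) :
  (forall i, measurable (h @^-1` [set i])) ->
  mu [set w | A (h w)] = \sum_(i | A i) mu (h @^-1` [set i]).
Proof.
move=> mh; rewrite fiber_bigcup measure_fin_bigcup//; last first.
  by move=> i j _ _ [w [/= -> ->]].
  exact: finite_finset.
rewrite (fsbigE (enum [pred i | A i])) ?enum_uniq//.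
- rewrite big_enum_cond; apply: eq_bigl => i; rewrite inE mem_setE andbb //.
- by move=> i /=; rewrite mem_enum.
- by move=> i Ai; rewrite mem_enum inE Ai.
Qed.

Lemma fine_probability_fibers (W : finType) (h : Omega -> W) (A : pred W) :
  (forall i, measurable (h @^-1` [set i])) ->
  fine (mu [set w | A (h w)]) = (\sum_(i | A i) fine (mu (h @^-1` [set i])))%R.
Proof.
move=> mh; rewrite probability_fibers// -sum_fine// => i _.
exact: fin_num_measure.
Qed.

Lemma sum_fine_fibers (W : finType) (h : Omega -> W) :
  (forall i, measurable (h @^-1` [set i])) ->
  (\sum_i fine (mu (h @^-1` [set i])) = 1)%R.
Proof.
move=> mh; rewrite -(fine_probability_fibers xpredT)//.
by rewrite (_ : [set w | _] = setT) ?probability_setT//; apply/seteqP; split.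
Qed.

Lemma markov_fibers (W : finType) (h : Omega -> W) (phi : W -> R) (t : R) :
  (forall i, measurable (h @^-1` [set i])) -> (forall i, 0 <= phi i)%R -> (0 < t)%R ->
  mu [set w | (t <= phi (h w))%R] <=
  (t^-1 * \sum_i fine (mu (h @^-1` [set i])) * phi i)%:E.
Proof.
move=> mh phi0 t0.
have mE : measurable [set w | (t <= phi (h w))%R].
  exact: (measurable_fibers (fun i => (t <= phi i)%R)).
rewrite -(fineK (fin_num_measure mu _ mE)) lee_fin.
rewrite (fine_probability_fibers (fun i => (t <= phi i)%R))// ler_pdivlMl//.
rewrite mulr_sumr [leRHS](bigID (fun i => (t <= phi i)%R))/= -[leLHS]addr0.
apply: lerD.
  by apply: ler_sum => i ti; rewrite mulrC ler_wpM2l// fine_ge0.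
by apply: sumr_ge0 => i _; rewrite mulr_ge0// fine_ge0.
Qed.

(** The first Borel-Cantelli lemma, with summability given by partial sums. *)
Lemma eventually_notin (F : nat -> set Omega) (r : nat -> R) (C : R) :
  (forall k, measurable (F k)) -> (forall k, mu (F k) <= (r k)%:E) ->
  (forall k, \sum_(0 <= i < k) r i <= C)%R ->
  {ae mu, forall w, exists k0, forall k, (k0 <= k)%N -> ~ F k w}.
Proof.
move=> mF muF rC.
have : mu (lim_sup_set F) = 0.
  apply: lim_sup_set_cvg0 => //; apply: le_lt_trans (ltry C).
  apply: lime_le; first by apply: is_cvg_nneseries => n _ _; exact: measure_ge0.
  apply: nearW => k; rewrite (le_trans (lee_sum _ (fun i _ => muF i)))//.
  by rewrite sumEFin lee_fin.
move=> muF0; exists (lim_sup_set F); split => //.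
  apply: bigcapT_measurable => n; apply: bigcup_measurable => k _; exact: mF.
move=> w /= nex n _; apply: contrapT => nF; apply: nex; exists n => k nk Fk.
by apply: nF; exists k.
Qed.

Lemma geometric_partial_le (b : R) k : (0 <= b < 1)%R ->
  (\sum_(0 <= i < k) b ^+ i <= (1 - b)^-1)%R.
Proof.
move=> /andP[b0 b1]; have b1' : (0 < 1 - b)%R by lra.
rewrite -[leRHS]mul1r ler_pdivlMr// mulrC.
have := subrX1 b k; rewrite big_mkord => h.
have : (0 <= b ^+ k)%R by rewrite exprn_ge0.
lra.
Qed.

(** For discrete variables, mutual independence is the product rule on points. *)
Definition independent_labels (J : nat -> Omega -> nat) :=
  forall (S : {fset nat}) (c : nat -> nat),
  mu (\bigcap_(j in [set` S]) (J j @^-1` [set c j])) =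
  \prod_(j <- S) mu (J j @^-1` [set c j]).

End finite_labels.

(** Take the largest [n ^ j <= t / q]: then [0, t) consists of fewer than [n * q]
    full blocks of length [n ^ j], and of a remainder that is at most a fraction
    [1 / q] of it. *)
Lemma block_interpolation (R : realType) (X : normedModType R) (x : nat -> X)
    (M : R) (n q j0 : nat) : (1 < n)%N -> (0 < q)%N ->
  (forall i, `|x i| <= M) ->
  (forall j l, (j0 <= j)%N -> (l < n * q)%N ->
    `|\sum_(k < n ^ j) x (l * n ^ j + k)%N| <= (n ^ j)%:R / q%:R) ->
  forall t, (q * n ^ j0 <= t)%N -> `|\sum_(i < t) x i| <= (1 + M) / q%:R * t%:R.
Proof.
move=> n1 q0 xM blk t ht.
have nj0 : (0 < n ^ j0)%N by rewrite expn_gt0 ltnW.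
have tq : (n ^ j0 <= t %/ q)%N by rewrite leq_divRL// mulnC.
have tq0 : (0 < t %/ q)%N by exact: leq_trans nj0 tq.
pose j := trunc_log n (t %/ q).
have /andP[jl ju] := trunc_log_bounds n1 tq0; rewrite -/j in jl ju.
have j0j : (j0 <= j)%N by exact: trunc_log_max.
pose N := (n ^ j)%N; have N0 : (0 < N)%N by rewrite expn_gt0 ltnW.
have qN : (q * N <= t)%N by rewrite mulnC -leq_divRL.
pose m := (t %/ N)%N.
have mnq : (m < n * q)%N.
  by rewrite ltn_divLR// mulnAC /N -expnS -ltn_divLR.
have tE : t = (m * N + t %% N)%N by rewrite -divn_eq.
have rN : (t %% N < N)%N by rewrite ltn_mod.
have M0 : 0 <= M by rewrite (le_trans _ (xM 0%N)).
have -> : \sum_(i < t) x i = \sum_(l < m) \sum_(k < N) x (l * N + k)%N +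
    \sum_(k < t %% N) x (m * N + k)%N.
  rewrite -(big_mkord xpredT x) (big_cat_nat (n := (m * N)%N))//=; last first.
    by rewrite [leqRHS]tE leq_addr.
  congr (_ + _).
    rewrite big_nat_mul big_mkord; apply: eq_bigr => l _.
    rewrite -{1}[(l * N)%N]add0n big_addn mulSn addnK big_mkord.
    by apply: eq_bigr => k _; rewrite addnC.
  rewrite -{1}[(m * N)%N]add0n big_addn {1}tE addKn big_mkord.
  by apply: eq_bigr => k _; rewrite addnC.
rewrite (le_trans (ler_normD _ _))//.
have h1 : `|\sum_(l < m) \sum_(k < N) x (l * N + k)%N| <= m%:R * (N%:R / q%:R).
  rewrite (le_trans (ler_norm_sum _ _ _))//.
  rewrite -[m in leRHS]card_ord mulr_natl -sumr_const ler_sum// => l _.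
  by rewrite blk// (ltn_trans (ltn_ord l)).
have h2 : `|\sum_(k < t %% N) x (m * N + k)%N| <= N%:R * M.
  rewrite (le_trans (ler_norm_sum _ _ _))//.
  apply: (@le_trans _ _ (\sum_(k < t %% N) M)); first exact: ler_sum.
  by rewrite sumr_const card_ord -[M *+ _]mulr_natl ler_wpM2r// ler_nat ltnW.
apply: le_trans (lerD h1 h2) _.
have q0' : (0 : R) < q%:R by rewrite ltr0n.
rewrite mulrAC mulrDl mul1r mulrDl lerD//.
  by rewrite mulrA ler_wpM2r ?invr_ge0 ?(ltW q0')// -natrM ler_nat leq_divM.
rewrite ler_pdivlMr// mulrAC [leRHS]mulrC ler_wpM2r//.
by rewrite -natrM ler_nat mulnC.
Qed.

(** * The strong law of large numbers in B-convex spaces *)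

Section label_slln.
Context (R : realType) (X : normedModType R) d (Omega : measurableType d)
  (mu : probability Omega R).
Variables (J : nat -> Omega -> nat) (m : nat -> nat).
Hypothesis mJ : forall i c, measurable (J i @^-1` [set c]).
Hypothesis Jm : forall i w, (J i w < m i)%N.
Hypothesis indJ : independent_labels mu J.

Let pr i (c : nat) : R := fine (mu (J i @^-1` [set c])).

Section centered.
Variables (a : nat -> nat -> X) (M : R).
Hypothesis aM : forall i c, `|a i c| <= M.
Hypothesis a0 : forall i, \sum_(c < m i) pr i c *: a i c = 0.

Let block o N w : X := \sum_(k < N) a (o + k)%N (J (o + k)%N w).

(** On a block the labels have a finite product law, so [pmean_rad] bounds the
    second moment of the block sum. *)
Lemma block_tail (I : finType) (b t : R) (o : nat) : 0 <= b -> 0 < t ->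
  rad_bound X I b ->
  measurable [set w | t <= `|block o #|I| w|] /\
  (mu [set w | (t <= `|block o #|I| w|)%R] <=
   ((t ^+ 2)^-1 * (4 * b * (#|I|%:R * M) ^+ 2))%:E)%E.
Proof.
move=> b0 t0 Ib.
pose g (i : I) := (o + enum_rank i)%N.
have g_inj : injective g.
  by move=> i j /addnI/ord_inj/enum_rank_inj.
(* all the labels of the block lie below [K.+1], hence in a finite type *)
pose K := \max_(k < #|I|) m (o + k).
have mK i : (m (g i) <= K)%N.
  exact: (leq_bigmax (F := fun k : 'I_#|I| => m (o + k)) (enum_rank i)).
have JK i w : (J (g i) w < K.+1)%N by rewrite (leq_trans (Jm _ _))// ltnW// ltnS.
pose h w : {ffun I -> 'I_K.+1} := [ffun i => inord (J (g i) w)].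
pose S : {fset nat} := [fset g i | i in I]%fset.
pose c (f : {ffun I -> 'I_K.+1}) j : nat :=
  if [pick i | g i == j] is Some i then f i else 0%N.
have cg f i : c f (g i) = f i.
  rewrite /c; case: pickP => [i' /eqP/g_inj -> //|/(_ i)].
  by rewrite eqxx.
have hE f : h @^-1` [set f] = \bigcap_(j in [set` S]) (J j @^-1` [set c f j]).
  apply/seteqP; split=> [w /= <- _ /imfsetP[i _ ->]|w /= wJ].
    by rewrite /= cg ffunE inordK.
  apply/ffunP => i; rewrite ffunE; apply: ord_inj; rewrite inordK// -cg.
  by apply: (wJ (g i)); rewrite /=; apply/imfsetP; exists i.
have mh f : measurable (h @^-1` [set f]).
  by rewrite hE; apply: fin_bigcap_measurable => // j _; exact: mJ.
pose p i (w : 'I_K.+1) := pr (g i) w.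
have prh f : fine (mu (h @^-1` [set f])) = pweight p f.
  rewrite hE indJ /S big_imfset/=; last by move=> i j _ _; exact: g_inj.
  rewrite /pweight /p /pr big_enum/=.
  under eq_bigr do rewrite cg -[mu _]fineK ?fin_num_measure//.
  by rewrite prodEFin.
have p0 i w : 0 <= p i w by rewrite fine_ge0.
have p1 i : \sum_w p i w = 1.
  have mhi w : measurable ((fun w => inord (J (g i) w) : 'I_K.+1) @^-1` [set w]).
    rewrite (_ : _ @^-1` _ = J (g i) @^-1` [set w : nat])//.
    apply/seteqP; split=> x /=; first by move=> <-; rewrite inordK.
    by move=> ->; rewrite inord_val.
  rewrite -(sum_fine_fibers mu mhi); apply: eq_bigr => w _.
  rewrite /p /pr; congr (fine (mu _)).
  apply/seteqP; split=> x /=; last by move=> <-; rewrite inordK.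
  by move=> ->; rewrite inord_val.
have a0' i : \sum_w p i w *: a (g i) w = 0.
  rewrite -(big_mkord xpredT (fun w => pr (g i) w *: a (g i) w)).
  rewrite (big_cat_nat (n := m (g i)))//=; last exact: leqW.
  rewrite big_mkord a0 add0r big_nat big1// => k /andP[mk _].
  rewrite /pr (_ : _ @^-1` _ = set0) ?measure0 ?scale0r//.
  by apply/seteqP; split=> // w /= E; move: (Jm (g i) w); rewrite E ltnNge mk.
pose phi (f : {ffun I -> 'I_K.+1}) := `|\sum_i a (g i) (f i)| ^+ 2.
have blockE : [set w | t <= `|block o #|I| w|] = [set w | t ^+ 2 <= phi (h w)].
  have bE w : block o #|I| w = \sum_i a (g i) (h w i).
    rewrite /block (reindex (@enum_rank I)); last exact: onW_bij (@enum_rank_bij I).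
    by apply: eq_bigr => i _; rewrite ffunE inordK.
  apply/seteqP; split=> w /=; rewrite bE /phi ler_sqr ?nnegrE// ltW//.
rewrite blockE; split; first exact: (measurable_fibers (fun f => t ^+ 2 <= phi f)).
have phi0 f : 0 <= phi f by exact: sqr_ge0.
apply: le_trans (markov_fibers mu mh phi0 (exprn_gt0 2 t0)) _.
rewrite lee_fin ler_wpM2l ?invr_ge0 ?sqr_ge0//.
under eq_bigr do rewrite prh.
exact: (pmean_rad p0 p1 b0 Ib a0').
Qed.

(** The [n * q] first blocks of length [n ^ j] all have a small sum, except on an
    event of probability [O(b ^ j)]; so almost surely this holds for all large
    [j], and [q] can then be taken arbitrarily large in the interpolation. *)
Theorem label_slln : B_convex X ->
  {ae mu, forall w, forall e, 0 < e ->
    exists t0, forall t, (t0 <= t)%N ->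
      `|\sum_(i < t) a i (J i w)| <= e * t%:R}.
Proof.
move=> /rad_bound_base[n [n1 [b [b0 b1 nb]]]].
have M0 : 0 <= M by rewrite (le_trans _ (aM 0%N 0%N)).
have key q : (0 < q)%N -> {ae mu, forall w, exists j0, forall j l, (j0 <= j)%N ->
    (l < n * q)%N -> `|block (l * n ^ j) (n ^ j) w| <= (n ^ j)%:R / q%:R}.
  move=> q0.
  have q0' : (0 : R) < q%:R by rewrite ltr0n.
  pose th j : R := (n ^ j)%:R / q%:R.
  have nj0 j : (0 : R) < (n ^ j)%:R by rewrite ltr0n expn_gt0 ltnW.
  have th0 j : 0 < th j by rewrite divr_gt0.
  pose E j l := [set w | th j <= `|block (l * n ^ j) (n ^ j) w|].
  pose F j := \big[setU/set0]_(l < n * q) E j l.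
  pose C : R := 4 * M ^+ 2 * q%:R ^+ 2.
  have C0 : 0 <= C by rewrite !mulr_ge0 ?sqr_ge0.
  have EP j l : measurable (E j l) /\ (mu (E j l) <= (C * b ^+ j)%:E)%E.
    have := block_tail (l * n ^ j) (exprn_ge0 j b0) (th0 j) (rad_bound_ipow (j := j) b0 nb).
    rewrite card_ipow => -[mE muE]; split => //.
    apply: le_trans muE _; rewrite lee_fin le_eqVlt; apply/orP; left; apply/eqP.
    rewrite /C /th; field. by rewrite !gt_eqF.
  have mF j : measurable (F j).
    apply: bigsetU_measurable => l _. exact: (EP j l).1.
  have muF j : (mu (F j) <= ((n * q)%:R * C * b ^+ j)%:E)%E.
    have mE l : (l < n * q)%N -> measurable (E j l) by move=> _; exact: (EP j l).1.
    apply: le_trans (Boole_inequality mu mE) _.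
    apply: (@le_trans _ _ (\sum_(l < n * q) (C * b ^+ j)%:E)%E).
      by apply: lee_sum => l _; exact: (EP j l).2.
    by rewrite sumEFin sumr_const card_ord lee_fin -[_ *+ (n * q)]mulr_natl mulrA.
  have partial k : \sum_(0 <= j < k) ((n * q)%:R * C * b ^+ j) <=
      (n * q)%:R * C * (1 - b)^-1.
    rewrite -mulr_sumr ler_wpM2l ?mulr_ge0//.
    by apply: geometric_partial_le; rewrite b0 b1.
  apply: filterS (eventually_notin mF muF partial) => w [j0 j0F].
  exists j0 => j l j0j lnq; rewrite leNgt; apply/negP => lt.
  apply: (j0F j j0j); rewrite /F -(bigcup_mkord _ (E j)).
  by exists l => //; exact: ltW.
have /ae_foralln := fun q => key q.+1 erefl.
apply: filterS => w wblk e e0.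
pose q := (Num.truncn ((1 + M) / e)).
have qe : (1 + M) / q.+1%:R <= e.
  rewrite ler_pdivrMr ?ltr0n// mulrC -ler_pdivrMr//.
  by rewrite ltW// truncnS_gt.
have [j0 hj0] := wblk q.
exists (q.+1 * n ^ j0)%N => t tj0.
apply: le_trans (block_interpolation (x := fun i => a i (J i w)) n1 (ltn0Sn q) _ hj0 tj0) _.
  by move=> i; exact: aM.
by rewrite ler_wpM2r.
Qed.
End centered.
End label_slln.

(** * Finite nets in finite-dimensional subspaces and on the dual sphere *)

Section nets.
Context (R : realType).

(** Two points are close for all [phi i] when the integer parts of the rescaled
    values agree, and these take finitely many values. *)
Lemma finite_net (T : Type) (S : set T) (r : nat) (phi : 'I_r -> T -> R) (M e : R) :
  (forall i x, S x -> `|phi i x| <= M) -> 0 < e ->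
  exists n (y : 'I_n -> T), forall x, S x ->
    exists k, forall i, `|phi i x - phi i (y k)| <= e.
Proof.
move=> phiM e0.
have [S0|/set0P[x0 Sx0]] := eqVneq S set0.
  by exists 0%N, (fun k : 'I_0 => False_rect T (notF (ltn_ord k))) => x; rewrite S0.
pose K := Num.truncn (2 * M / e).
pose key x : {ffun 'I_r -> 'I_K.+1} :=
  [ffun i => inord (Num.truncn ((phi i x + M) / e))].
(* equal integer parts differ by less than one unit [e] after rescaling *)
have key_close x y : S x -> S y -> key x = key y ->
    forall i, `|phi i x - phi i y| <= e.
  move=> Sx Sy kxy i.
  have b z : S z -> (0 <= (phi i z + M) / e) /\
      (Num.truncn ((phi i z + M) / e) <= K)%N.
    move=> Sz; have := phiM i z Sz; rewrite ler_norml => /andP[l u].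
    split; first by apply: divr_ge0; lra.
    apply: le_truncn; rewrite ler_pM2r ?invr_gt0//; lra.
  have [x0' xK] := b x Sx; have [y0' yK] := b y Sy.
  have /(congr1 (fun f : {ffun 'I_r -> 'I_K.+1} => val (f i))) := kxy.
  rewrite !ffunE/= !inordK ?ltnS// => kk.
  have /andP[lx ux] := truncn_itv x0'; have /andP[ly uy] := truncn_itv y0'.
  have h : `|(phi i x + M) / e - (phi i y + M) / e| <= 1.
    move: lx ux ly uy; rewrite kk -natr1 => *; rewrite ler_norml; lra.
  move: h; rewrite -mulrBl opprD addrACA subrr addr0 normrM normfV (gtr0_norm e0).
  by rewrite ler_pdivrMr// mul1r.
pose rep (l : {ffun 'I_r -> 'I_K.+1}) :=
  if pselect (exists x, S x /\ key x = l) is left h then projT1 (cid h) else x0.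
exists #|{: {ffun 'I_r -> 'I_K.+1}}|, (fun k => rep (enum_val k)) => x Sx.
exists (enum_rank (key x)); rewrite enum_rankK /rep.
case: pselect => [h|[]]; last by exists x.
by case: (cid h) => y [Sy kyx] /=; exact: key_close.
Qed.

Context (X : normedModType R).

Lemma lin_spanD (A : set X) x y : lin_span A x -> lin_span A y -> lin_span A (x + y).
Proof.
move=> [n [a [c [Aa ->]]]] [m [b [e [Ab ->]]]].
exists (n + m)%N, (fun k : 'I_(n + m) => match fintype.split k with inl i => a i | inr j => b j end),
  (fun k : 'I_(n + m) => match fintype.split k with inl i => c i | inr j => e j end); split.
  by move=> k; case: fintype.split.
rewrite big_split_ord/=; congr (_ + _); apply: eq_bigr => i _.
  by rewrite (unsplitK (inl i : 'I_n + 'I_m)).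
by rewrite (unsplitK (inr i : 'I_n + 'I_m)).
Qed.

Lemma lin_spanZ (A : set X) (t : R) x : lin_span A x -> lin_span A (t *: x).
Proof.
move=> [n [a [c [Aa ->]]]]; exists n, a, (fun i => t * c i); split => //.
by rewrite scaler_sumr; apply: eq_bigr => i _; rewrite scalerA.
Qed.

Lemma sub_lin_span (A : set X) : A `<=` lin_span A.
Proof.
move=> x Ax; exists 1%N, (fun=> x), (fun=> 1); split => //.
by rewrite big_ord1 scale1r.
Qed.

Let sp (e : nat -> X) := fix sp n : set X :=
  if n is n'.+1 then [set y + c *: e n' | y in sp n' & c in [set: R]] else [set 0].

Let sp0 e n : sp e n 0.
Proof.
by elim: n => // n IH; exists 0 => //; exists 0 => //; rewrite scale0r addr0.
Qed.

Let spD e n x y : sp e n x -> sp e n y -> sp e n (x + y).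
Proof.
elim: n x y => [|n IH] x y /=; first by move=> -> ->; rewrite /= addr0.
move=> [x' hx [c _ <-]] [y' hy [b _ <-]]; exists (x' + y'); first exact: IH.
by exists (c + b) => //; rewrite scalerDl addrACA.
Qed.

Let spZ e n (t : R) x : sp e n x -> sp e n (t *: x).
Proof.
elim: n x => [|n IH] x /=; first by move=> ->; rewrite /= scaler0.
move=> [x' hx [c _ <-]]; exists (t *: x'); first exact: IH.
by exists (t * c) => //; rewrite scalerDr scalerA.
Qed.

(** Either the last generator stays away from the span of the others, and its
    coefficient is bounded, or it can be replaced by a point of that span. *)
Let sp_tb (e : nat -> X) n (M r : R) : 0 < r ->
  exists k (y : 'I_k -> X), forall x, sp e n x -> `|x| <= M ->
    exists i, `|x - y i| <= r.
Proof.
elim: n M r => [|n IH] M r r0.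
  by exists 1%N, (fun=> 0) => x /= -> _; exists ord0; rewrite subrr normr0 ltW.
have r2 : 0 < r / 2 by rewrite divr_gt0.
have [[dlt [dlt0 far]]|near] :=
    pselect (exists dlt : R, 0 < dlt /\ forall y, sp e n y -> dlt <= `|e n - y|).
  have coef y c : sp e n y -> `|y + c *: e n| <= M -> `|c| <= M / dlt.
    move=> hy; rewrite ler_pdivlMr//; apply: le_trans.
    have [->|c0] := eqVneq c 0; first by rewrite normr0 mul0r.
    have -> : y + c *: e n = c *: (e n - (- c^-1) *: y).
      by rewrite scalerBr scalerA mulrN divff// scaleN1r opprK addrC.
    by rewrite normrZ ler_wpM2l// far//; exact: spZ.
  have [k [z hz]] := IH (M + M / dlt * `|e n|) (r / 2) r2.
  pose h := r / 2 / (`|e n| + 1).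
  have en1 : 0 < `|e n| + 1 by rewrite ltr_wpDl.
  have h0 : 0 < h by rewrite divr_gt0.
  (* the coefficient of [e n] is bounded and ranges over a finite net too *)
  have [l [g hg]] := @finite_net R [set c | `|c| <= M / dlt] 1 (fun _ c => c)
    (M / dlt) h (fun _ _ => id) h0.
  exists #|{: 'I_k * 'I_l}|, (fun i => z (enum_val i).1 + g (enum_val i).2 *: e n).
  move=> _ [y hy [c _ <-]] hx.
  have hc := coef y c hy hx.
  have hy' : `|y| <= M + M / dlt * `|e n|.
    rewrite -[y](addrK (c *: e n)) (le_trans (ler_normB _ _))// lerD//.
    by rewrite normrZ ler_wpM2r.
  have [i hi] := hz y hy hy'; have [j hj] := hg c hc.
  exists (enum_rank (i, j)); rewrite enum_rankK/= opprD addrACA -scalerBl.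
  rewrite (le_trans (ler_normD _ _))// [r in leRHS]splitr lerD//.
  rewrite normrZ (le_trans (ler_wpM2r _ (hj ord0)))// /h mulrAC ler_pdivrMr//.
  by rewrite ler_pM2l// lerDl.
have [k [z hz]] := IH (M + r / 2) (r / 2) r2.
exists k, z => _ [y hy [c _ <-]] hx.
have c1 : 0 < `|c| + 1 by rewrite ltr_wpDl.
have d0 : 0 < r / 2 / (`|c| + 1) by rewrite divr_gt0.
have [v [hv ev]] : exists v, sp e n v /\ `|e n - v| <= r / 2 / (`|c| + 1).
  apply: contrapT => nv; apply: near; exists (r / 2 / (`|c| + 1)); split => // v hv.
  by rewrite leNgt; apply/negP => /ltW ?; apply: nv; exists v.
have cv : `|c *: (e n - v)| <= r / 2.
  rewrite normrZ mulrC (le_trans (ler_wpM2r _ ev))// mulrAC ler_pdivrMr//.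
  by rewrite ler_pM2l// lerDl.
have E : y + c *: v = y + c *: e n - c *: (e n - v).
  by rewrite scalerBr opprB addrA addrAC addrK.
have [||i hi] := hz (y + c *: v).
- by apply: spD => //; exact: spZ.
- by rewrite E (le_trans (ler_normB _ _))// lerD.
exists i; have -> : y + c *: e n - z i = (y + c *: v - z i) + c *: (e n - v).
  by rewrite E [RHS]addrAC subrK.
by rewrite (le_trans (ler_normD _ _))// [r in leRHS]splitr lerD.
Qed.

Lemma lin_span_totally_bounded n (e : 'I_n -> X) (M r : R) : 0 < r ->
  exists k (y : 'I_k -> X), forall x, lin_span (range e) x -> `|x| <= M ->
    exists i, `|x - y i| <= r.
Proof.
move=> r0; pose e' k := if insub k is Some i then e i else 0.
have eE i : e' (val i) = e i by rewrite /e' valK.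
have spe m i : (i < m)%N -> sp e' m (e' i).
  elim: m => // m IH; rewrite ltnS leq_eqVlt => /predU1P[->|im].
    by exists 0; [exact: sp0|exists 1 => //; rewrite scale1r add0r].
  by exists (e' i); [exact: IH|exists 0 => //; rewrite scale0r addr0].
have [k [y hy]] := sp_tb e' n M r0.
exists k, y => x [m [a [c [ea ->]]]]; apply: hy.
elim/big_rec : _ => [|i u _ hu]; first exact: sp0.
apply: spD => //; apply: spZ; have [j _ <-] := ea i; rewrite -eE.
by apply: spe; exact: ltn_ord.
Qed.

(** On a bounded part of a finite-dimensional space a functional of norm one is
    known, up to a small error, from its values at the points of a finite net. *)
Lemma dual_sphere_net n (e : 'I_n -> X) (M r : R) : 0 < r ->
  exists k (g : 'I_k -> dual_sphere X), forall f : dual_sphere X, exists i,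
    forall x, lin_span (range e) x -> `|x| <= M ->
      `|(\val f : dual X) x - (\val (g i) : dual X) x| <= r.
Proof.
move=> r0; have r3 : 0 < r / 3 by rewrite divr_gt0.
have [k [y hy]] := lin_span_totally_bounded e M r3.
have [|l [g hg]] := @finite_net (dual_sphere X) setT k
    (fun i f => (\val f : dual X) (y i)) (\sum_i `|y i|) (r / 3) _ r3.
  move=> i f _; rewrite (le_trans (sphere_le f (y i)))//.
  by rewrite (bigD1 i)//= lerDl sumr_ge0.
exists l, g => f; have [j hj] := hg f I; exists j => x hx xM.
have [i hi] := hy x hx xM.
have := hj i; have := le_trans (sphere_le f (x - y i)) hi.
have := le_trans (sphere_le (g j) (x - y i)) hi.
rewrite !linearB/= !ler_norml; lra.
Qed.

End nets.

(** * Bounded functionals and the Bochner integral *)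

Section finite_valued_integral.
Context (R : realType) d (Omega : measurableType d) (mu : probability Omega R).
Local Open Scope ereal_scope.

Lemma integral_finite_valued (W : choiceType) (h : Omega -> W) (r : seq W)
    (phi : W -> R) : uniq r -> (forall w, h w \in r) ->
  (forall i, measurable (h @^-1` [set i])) ->
  mu.-integrable setT (fun w => (phi (h w))%:E) /\
  \int[mu]_w (phi (h w))%:E =
  (\sum_(i <- r) fine (mu (h @^-1` [set i])) * phi i)%:E.
Proof.
move=> ur hr mh.
have phiE w : (phi (h w))%:E =
    \sum_(i <- r) ((phi i)%:E * (\1_(h @^-1` [set i]) w)%:E).
  rewrite (big_rem (h w))//= indicE mem_set// mule1 big_seq big1 ?adde0// => i.
  rewrite rem_filter// mem_filter/= => /andP[hi _].
  by rewrite indicE memNset ?mule0// => /= /eqP; rewrite eq_sym (negPf hi).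
have intg i : mu.-integrable setT (fun w => (phi i)%:E * (\1_(h @^-1` [set i]) w)%:E).
  by apply: integrableZl => //; exact: integrable_indic.
have fE : (fun w => (phi (h w))%:E) = fun w =>
    \sum_(i <- r) ((phi i)%:E * (\1_(h @^-1` [set i]) w)%:E).
  by apply/funext.
rewrite fE; split; first exact: integrable_sum.
rewrite integral_sum// -sumEFin; apply: eq_bigr => i _.
rewrite integralZl//; last exact: integrable_indic.
rewrite integral_indic// setIT EFinM muleC fineK// fin_num_measure//.
Qed.
End finite_valued_integral.

Section bochner_functional.
Context (R : realType) d (Omega : measurableType d) (mu : probability Omega R)
  (V : normedModType R).
Variables (F : Omega -> V) (v : V) (M : R).
Hypothesis mF : forall G : set V, open G -> measurable (F @^-1` G).
Hypothesis FM : forall w, `|F w| <= M.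
Hypothesis intF : bochner_integral_is mu F v.

Variables (l : V -> R) (C : R).
Hypothesis lD : forall x y, l (x + y) = l x + l y.
Hypothesis lZ : forall t x, l (t *: x) = t * l x.
Hypothesis lC : forall x, `|l x| <= C * `|x|.

Let l0 : l 0 = 0. Proof. by rewrite -(scale0r 0) lZ mul0r. Qed.

Let lB x y : l (x - y) = l x - l y.
Proof. by rewrite lD -scaleN1r lZ mulN1r. Qed.

Let l_continuous : continuous (l : V -> R).
Proof.
have cZ : 0 < `|C| + 1 by rewrite ltr_wpDl.
move=> x; apply/cvgrPdist_le => e e0.
have ec : 0 < e / (`|C| + 1) by rewrite divr_gt0.
have /cvgrPdist_le/(_ _ ec) := @cvg_id _ (nbhs x).
apply: filterS => y /= xy; rewrite -lB (le_trans (lC _))//.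
apply: (@le_trans _ _ ((`|C| + 1) * `|x - y|)).
  by rewrite ler_wpM2r// (le_trans (ler_norm C))// lerDl.
by rewrite mulrC -ler_pdivlMr.
Qed.

Lemma measurable_functional : measurable_fun setT (fun w => l (F w)).
Proof.
apply: (measurability _ (RGenOInfty.measurableE R)) => _ [_ [r ->] <-].
rewrite setTI.
rewrite (_ : _ @^-1` _ = F @^-1` (l @^-1` `]r, +oo[%classic))//.
apply: mF; move/continuousP : l_continuous; apply.
exact: interval_open.
Qed.

Lemma integrable_functional : mu.-integrable setT (fun w => (l (F w))%:E).
Proof.
apply: measurable_bounded_integrable => //.
- by rewrite -ge0_fin_numE// fin_num_measure.
- exact: measurable_functional.
- exists (`|C| * M); split; first exact: num_real.
  move=> r Mr w _; rewrite /= (le_trans (lC _))// (le_trans _ (ltW Mr))//.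
  rewrite (le_trans (ler_wpM2r _ (ler_norm C)))// ler_wpM2l//.
Qed.

Lemma simple_integral_functional (s : Omega -> V) : simple_function s ->
  mu.-integrable setT (fun w => (l (s w))%:E) /\
  (\int[mu]_w (l (s w))%:E = (l (simple_integral mu s))%:E)%E.
Proof.
move=> [/finite_seqP[r0 sr0] ms]; pose r := undup r0.
have ur : uniq r by exact: undup_uniq.
have sr w : s w \in r.
  have : range s (s w) by exists w.
  by rewrite sr0 /= mem_undup.
have [intl ->] := integral_finite_valued mu l ur sr ms; split => //.
congr (_%:E); rewrite /simple_integral (fsbigE r)//; last first.
  move=> i _ ir; rewrite (_ : _ @^-1` _ = set0) ?measure0 ?scale0r//.
  by apply/seteqP; split=> // w /= swi; move: ir; rewrite -swi sr.
under eq_bigl do rewrite in_setT.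
by elim/big_rec2 : _ => [|i x y _ ->]; rewrite ?l0 ?lD ?lZ.
Qed.

Lemma measurable_norm_sub_simple (s : Omega -> V) : simple_function s ->
  measurable_fun setT (fun w => `|F w - s w|).
Proof.
move=> [fs ms].
apply: (measurability _ (RGenOInfty.measurableE R)) => _ [_ [r ->] <-].
rewrite setTI (_ : _ @^-1` _ = \bigcup_(i in range s)
    (s @^-1` [set i] `&` F @^-1` [set x | r < `|x - i|])).
  apply: fin_bigcup_measurable => // i _; apply: measurableI => //; apply: mF.
  rewrite (_ : [set x | _] = (fun x => `|x - i|) @^-1` `]r, +oo[%classic).
    apply: (@open_comp _ _ (fun x : V => `|x - i|)) => [x _|]; last exact: interval_open.
    by apply: cvg_norm; apply: cvgB; [exact: cvg_id|exact: cvg_cst].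
  by apply/seteqP; split=> x /=; rewrite in_itv/= andbT.
apply/seteqP; split=> w /=; rewrite in_itv/= andbT.
  by move=> h; exists (s w) => //; exists w.
by move=> [i _ [/= <-]].
Qed.

(** On simple functions this is [simple_integral_functional], and a bounded
    functional makes both sides continuous for the convergence in mean. *)
Lemma integral_functional : (\int[mu]_w (l (F w))%:E = (l v)%:E)%E.
Proof.
have [s [ss _ sF sv]] := intF.
have fin := integrable_fin_num measurableT integrable_functional.
rewrite -(fineK fin); congr (_%:E); set I := fine _.
apply/eqP; rewrite -subr_eq0 -normr_le0; apply/ler_addgt0Pl => e e0; rewrite addr0.
pose c := `|C| + 1.
have c0 : 0 < c by rewrite ltr_wpDl.
have e1 : 0 < e / (2 * c) by rewrite divr_gt0// mulr_gt0.
have near1 : \forall k \near \oo, (\int[mu]_w (`|F w - s k w|)%:E <= (e / (2 * c))%:E)%E.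
  have /fine_cvgP[fk /cvgrPdist_le/(_ _ e1)] := sF.
  apply: filter_app2 fk; near=> k => fk; rewrite /= sub0r normrN => h.
  by rewrite -(fineK fk) lee_fin (le_trans (ler_norm _)).
have near2 : \forall k \near \oo, `|v - simple_integral mu (s k)| <= e / (2 * c).
  by move/cvgrPdist_le : sv => /(_ _ e1).
near \oo => k.
have [ik intk] := simple_integral_functional (ss k).
have h1 : `|I - l (simple_integral mu (s k))| <= e / 2.
  rewrite -lee_fin -abse_EFin EFinB /I fineK// -intk -integralB_EFin//; last exact: integrable_functional.
  have mS : measurable_fun setT (EFin \o (fun w => `|F w - s k w|) : Omega -> \bar R).
    by apply/measurable_EFinP; exact: measurable_norm_sub_simple.
  have mlD : measurable_fun setT ((fun w => (l (F w))%:E - (l (s k w))%:E)%E : Omega -> \bar R).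
    by apply: emeasurable_funB;
      [have /integrableP[] := integrable_functional|have /integrableP[] := ik].
  apply: le_trans (le_abse_integral mu measurableT mlD) _.
  apply: (@le_trans _ _ (\int[mu]_w (c%:E * (`|F w - s k w|)%:E))%E).
    apply: ge0_le_integral => //.
    - exact: measurableT_comp.
    - exact: measurable_funeM.
    - move=> w _; rewrite -EFinB -EFinM abse_EFin lee_fin -lB (le_trans (lC _))//.
      by rewrite ler_wpM2r// (le_trans (ler_norm C))// lerDl.
  rewrite ge0_integralZl//; last by rewrite lee_fin ltW.
  apply: (@le_trans _ _ (c%:E * (e / (2 * c))%:E)%E).
    by rewrite lee_wpmul2l ?lee_fin ?(ltW c0)//; near: k.
  by rewrite -EFinM lee_fin le_eqVlt; apply/orP; left; apply/eqP; field; rewrite gt_eqF.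
have h2 : `|l (simple_integral mu (s k)) - l v| <= e / 2.
  rewrite -lB (le_trans (lC _))// (le_trans (_ : _ <= c * `|simple_integral mu (s k) - v|))//.
    by rewrite ler_wpM2r// (le_trans (ler_norm C))// lerDl.
  rewrite distrC (_ : e / 2 = c * (e / (2 * c))); last by field; rewrite gt_eqF.
  by rewrite ler_pM2l//; near: k.
have -> : I - l v = (I - l (simple_integral mu (s k))) + (l (simple_integral mu (s k)) - l v).
  by rewrite addrA subrK.
by rewrite (le_trans (ler_normD _ _))// [e in leRHS]splitr lerD.
Unshelve. all: by end_near.
Qed.

End bochner_functional.

(** * Random sets whose expectation lies in a subspace *)

(** The values of the approximating simple functions form a countable set. *)
Lemma bochner_essentially_separable (R : realType) d (Omega : measurableType d)
    (mu : probability Omega R) (V : normedModType R) (F : Omega -> V) (v : V) :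
  bochner_integral_is mu F v ->
  exists z : nat -> V, {ae mu, forall w, forall e : R, 0 < e ->
    exists k, `|F w - z k| < e}.
Proof.
move=> [s [ss sF _ _]].
have /choice[r hr] : forall k, exists r : seq V, range (s k) = [set` r].
  by move=> k; have [/finite_seqP] := ss k.
exists (fun n : nat => if (choice.unpickle n : option (nat * nat)) is Some (k, i)
  then nth 0 (r k) i else 0).
apply: filterS sF => w sFw e e0.
have /cvgrPdist_lt/(_ _ e0) := sFw.
move=> [k _ /(_ k (leqnn k))] /= lt.
have : range (s k) (s k w) by exists w.
rewrite hr /= => /(nthP 0)[i _ ri].
by exists (choice.pickle (k, i)); rewrite choice.pickleK ri.
Qed.

Section dual_sphere_extra.
Context (R : realType) (X : normedModType R).

Lemma sphere_opp (f : dual_sphere X) :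
  exists g : dual_sphere X, forall x, (\val g : dual X) x = - (\val f : dual X) x.
Proof.
have gs : dual_sphere X (- (\val f : dual X)).
  by rewrite /dual_sphere/= normrN; exact: (set_valP f).
by exists (SigSub (mem_set gs)) => x.
Qed.

Variable L : set X.
Hypotheses (LD : forall x y, L x -> L y -> L (x + y))
  (LZ : forall t x, L x -> L (t *: x)) (L0 : L 0).

(** A functional that is bounded below by [r > 0] on [x - L] vanishes on the
    subspace [L], by homogeneity. *)
Lemma separation_subspace (x : X) (r : R) : 0 < r ->
  (forall l, L l -> r <= `|x - l|) ->
  exists2 f : dual_sphere X, r <= (\val f : dual X) x &
    forall l, L l -> (\val f : dual X) l = 0.
Proof.
move=> r0 xr.
have [||c [l Ll <-]|f fr] := @separation _ _ [set x - l | l in L] r r0.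
- move=> s t _ _ s0 t0 [l Ll <-] [l' Ll' <-].
  have [st|st] := eqVneq (s + t) 0.
    exists (x - l); first by exists l.
    have s0' : s = 0 by lra.
    by have -> : t = 0; [lra|rewrite s0' addr0 !scale0r addr0].
  exists (x - (s + t)^-1 *: (s *: l + t *: l')).
    by eexists; last reflexivity; apply/LZ/LD; exact: LZ.
  by rewrite !scalerBr scalerA divff// scale1r opprD addrACA scalerDl.
- by exists (x - 0), 0.
- exact: xr.
exists f; first by have := fr (x - 0); rewrite subr0; apply; exists 0; rewrite ?subr0.
move=> l Ll; apply/eqP/negPn/negP => fl.
have := fr (x - ((\val f : dual X) x / (\val f : dual X) l) *: l).
have h : [set x - l | l in L] (x - ((\val f : dual X) x / (\val f : dual X) l) *: l).
  by eexists; last reflexivity; exact: LZ.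
move=> /(_ h); rewrite linearB linearZ/=.
by rewrite [X in _ - X](divfK fl) subrr leNgt r0.
Qed.

End dual_sphere_extra.

Section one_random_set.
Context (R : realType) (X : normedModType R) d (Omega : measurableType d)
  (mu : probability Omega R).
Variables (Psi : Omega -> BC X) (U : BC X) (M : R).
Hypothesis rPsi : random_set Psi.
Hypothesis PsiM : forall w a, (Psi w : set X) a -> `|a| <= M.
Hypothesis UM : forall a, (U : set X) a -> `|a| <= M.
Hypothesis EPsi : expectation_is mu Psi U.

Let F w := radstrom (Psi w).

Let M0 : 0 <= M.
Proof. by have [a Ua] := BC_nonempty U; exact: le_trans (UM Ua). Qed.

Let FM w : `|F w| <= M.
Proof. by apply: bcfun_norm_le => // f; apply: radstrom_abs_le => a; exact: PsiM. Qed.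

Lemma integral_evaluation (f : dual_sphere X) :
  mu.-integrable setT (fun w => (F w f)%:E) /\
  (\int[mu]_w (F w f)%:E = (radstrom U f)%:E)%E.
Proof.
have l1 (x : Zspace X) : `|x f| <= 1 * `|x| by rewrite mul1r bcfun_le_norm.
split; first exact: (@integrable_functional _ _ _ mu _ F M rPsi FM (fun z => z f) 1).
exact: (@integral_functional _ _ _ mu _ F _ M rPsi FM EPsi (fun z => z f) 1).
Qed.

Variable L : set X.
Hypotheses (LD : forall x y, L x -> L y -> L (x + y))
  (LZ : forall t x, L x -> L (t *: x)) (Lcl : closed L) (UL : (U : set X) `<=` L).

Let L0 : L 0.
Proof. by have [a Ua] := BC_nonempty U; rewrite -(scale0r a); apply: LZ; exact: UL. Qed.

(** The width of [Psi] in a direction vanishing on [L] is nonnegative with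
    mean the width of [U], that is [0]. *)
Lemma ae_width0 (f g : dual_sphere X) :
  (forall x, (\val g : dual X) x = - (\val f : dual X) x) ->
  (forall l, L l -> (\val f : dual X) l = 0) ->
  {ae mu, forall w, F w f + F w g = 0}.
Proof.
move=> gf fL.
have w0 w : 0 <= F w f + F w g.
  have [a Pa] := BC_nonempty (Psi w).
  have := radstrom_ge f Pa; have := radstrom_ge g Pa; rewrite gf /F; lra.
have hU (h : dual_sphere X) : (forall l, L l -> (\val h : dual X) l = 0) ->
    radstrom U h = 0.
  move=> hL; apply/eqP; rewrite eq_le; apply/andP; split.
    by apply: radstrom_le => a /UL/hL ->.
  by have [a Ua] := BC_nonempty U; rewrite -(hL a (UL Ua)) radstrom_ge.
have [intf If] := integral_evaluation f; have [intg Ig] := integral_evaluation g.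
have I0 : (\int[mu]_w ((F w f)%:E + (F w g)%:E) = 0)%E.
  rewrite integralD// If Ig !hU ?adde0// => l Ll.
  by rewrite gf fL// oppr0.
have mfg : measurable_fun setT (fun w => (F w f)%:E + (F w g)%:E)%E.
  by apply: emeasurable_funD; [have /integrableP[] := intf|have /integrableP[] := intg].
have /(ae_eq_integral_abs mu measurableT mfg) :
    (\int[mu]_w `|(F w f)%:E + (F w g)%:E| = 0)%E.
  by rewrite -[RHS]I0; apply: eq_integral => w _; rewrite -EFinD gee0_abs// lee_fin.
by apply: filterS => w /(_ I) /= [].
Qed.

Let width_gap (q x y x' y' a b : R) : 0 < q -> x <= x' + 2 * (q / 8) ->
  y <= y' + 2 * (q / 8) -> a <= x -> - b <= y -> q <= a - b -> x' + y' = 0 -> False.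
Proof. by lra. Qed.

(** Suppose that a value of [Psi] has two points whose difference is at distance
    [1 / (k + 1)] from [L]. A functional vanishing on [L] gives it a positive
    width, and the same functional gives a positive width to all values of [Psi]
    whose support functions are close to that one: they form a null event. By
    essential separability, countably many such events suffice. *)
Lemma ae_diff_in_subspace :
  {ae mu, forall w, forall a b, (Psi w : set X) a -> (Psi w : set X) b -> L (a - b)}.
Proof.
have [z dz] := bochner_essentially_separable EPsi.
pose far (k : nat) w := exists a b, [/\ (Psi w : set X) a, (Psi w : set X) b &
  forall l, L l -> k.+1%:R^-1 <= `|a - b - l|].
pose r (k : nat) : R := k.+1%:R^-1 / 8.
have key k j : {ae mu, forall w, `|F w - z j| < r k -> ~ far k w}.
  have [[w0 [far0 near0]]|nw0] := pselect (exists w0, far k w0 /\ `|F w0 - z j| < r k).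
    have [a [b [Pa Pb ab]]] := far0.
    have k0 : (0 : R) < k.+1%:R^-1 by rewrite invr_gt0.
    have [f fab fL] := separation_subspace LD LZ L0 k0 ab.
    have [g gf] := sphere_opp f.
    apply: filterS (ae_width0 gf fL) => w wd near _.
    have ev (h : dual_sphere X) : F w0 h <= F w h + 2 * r k.
      have := bcfun_le_norm (F w0 - F w) h.
      have : `|F w0 - F w| <= 2 * r k.
        rewrite -(subrKA (z j)) -[z j - F w]opprB mulr_natl mulr2n.
        exact: le_trans (ler_normB _ _) (lerD (ltW near0) (ltW near)).
      move=> h1 h2; have := le_trans h2 h1.
      by rewrite -lerBlDl; exact: le_trans (ler_norm _).
    have h1 := ev f; have h2 := ev g.
    have h3 : (\val f : dual X) a <= F w0 f by exact: radstrom_ge.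
    have h4 : - (\val f : dual X) b <= F w0 g by rewrite -gf; exact: radstrom_ge.
    have h5 : k.+1%:R^-1 <= (\val f : dual X) a - (\val f : dual X) b by rewrite -linearB.
    exact: (width_gap k0 h1 h2 h3 h4 h5 wd).
  apply: aeW => w near fw; apply: nw0; exists w; split => //.
have /ae_foralln := fun k => ae_foralln (key k).
move=> h; apply: filterS2 dz h => w dzw h a b Pa Pb.
apply: contrapT => nL.
have : nbhs (a - b) (~` L) by apply: open_nbhs_nbhs; split => //; exact: closed_openC.
move=> /nbhs_ballP[e /= e0 eL].
pose k := Num.truncn e^-1.
have ke : k.+1%:R^-1 <= e.
  by rewrite invf_ple ?posrE// ltW// truncnS_gt.
have rk0 : 0 < r k by rewrite divr_gt0// invr_gt0.
have [j] := dzw _ rk0; move=> /(h k j); apply; exists a, b; split => // l Ll.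
rewrite leNgt; apply/negP => lt; apply: (eL l) => //.
by rewrite -ball_normE/= (lt_le_trans lt).
Qed.

End one_random_set.

(** * Finitely valued approximation of a random set *)

Section cells.
Context (R : realType) (V : normedModType R).

(** The value [size zs] marks the points outside all the balls. *)
Definition cell (zs : seq V) (e : R) (x : V) : nat :=
  find (fun z => `|x - z| < e) zs.

Lemma open_norm_lt (z : V) (e : R) : open [set x | `|x - z| < e].
Proof.
rewrite (_ : [set x | _] = (fun x => `|x - z|) @^-1` `]-oo, e[%classic).
  apply: (@open_comp _ _ (fun x : V => `|x - z|)) => [x _|]; last exact: interval_open.
  by apply: cvg_norm; apply: cvgB; [exact: cvg_id|exact: cvg_cst].
by apply/seteqP; split=> x /=; rewrite in_itv.
Qed.

Lemma cell_borel (zs : seq V) (e : R) (c : nat) :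
  borel_set [set x | cell zs e x = c].
Proof.
rewrite /borel_set -[X in X _]/((@open V).-sigma.-measurable).
elim: zs c => [|z zs IH] c /=.
  have [->|c0] := eqVneq c 0%N.
    by rewrite (_ : [set x | _] = setT)//; apply/seteqP; split.
  rewrite (_ : [set x | _] = set0)//; apply/seteqP; split=> // x /= c0'.
  by rewrite -c0' in c0.
have mz : (@open V).-sigma.-measurable [set x | `|x - z| < e].
  by apply: sub_sigma_algebra; exact: open_norm_lt.
case: c => [|c].
  rewrite (_ : [set x | _] = [set x | `|x - z| < e])//.
  by apply/seteqP; split=> x /=; case: ifP.
rewrite (_ : [set x | _] = ~` [set x | `|x - z| < e] `&` [set x | cell zs e x = c]).
  by apply: measurableI; [exact: measurableC|exact: IH].
apply/seteqP; split=> x /=; rewrite /cell/=; case: ifP => //.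
  by move=> _ [].
- by move=> _ [].
- by move=> _ [_ ->].
Qed.

Lemma measurable_preimage_borel d (Omega : measurableType d) (F : Omega -> V) (B : set V) :
  (forall G : set V, open G -> measurable (F @^-1` G)) ->
  borel_set B -> measurable (F @^-1` B).
Proof.
move=> mF; apply: (@smallest_sub _ _ _ [set B | measurable (F @^-1` B)]).
  split => [|A mA|A mA] /=.
  - by rewrite preimage_set0.
  - by rewrite setTD preimage_setC; exact: measurableC.
  - by rewrite preimage_bigcup; apply: bigcup_measurable => k _; exact: mA.
by move=> G; exact: mF.
Qed.

End cells.

Section discretization.
Context (R : realType) (X : normedModType R) d (Omega : measurableType d)
  (mu : probability Omega R).
Variables (Psi : Omega -> BC X) (U : BC X) (M : R).
Hypothesis rPsi : random_set Psi.
Hypothesis PsiM : forall w a, (Psi w : set X) a -> `|a| <= M.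
Hypothesis UM : forall a, (U : set X) a -> `|a| <= M.
Hypothesis EPsi : expectation_is mu Psi U.
Variable L : set X.
Hypotheses (LD : forall x y, L x -> L y -> L (x + y))
  (LZ : forall t x, L x -> L (t *: x)) (Lcl : closed L) (UL : (U : set X) `<=` L).

Let F w := radstrom (Psi w).

Let mF : forall G : set (Zspace X), open G -> measurable (F @^-1` G).
Proof. exact: rPsi. Qed.

(** The complements of growing unions of balls with dense centres decrease to a
    null event. *)
Lemma small_junk (e : R) : 0 < e -> exists zs : seq (Zspace X),
  (mu [set w | cell zs e (F w) = size zs] <= e%:E)%E.
Proof.
move=> e0; have [z dz] := bochner_essentially_separable EPsi.
pose zs n := [seq z i | i <- iota 0 n].
pose D n := [set w | cell (zs n) e (F w) = size (zs n)].
have DP n w : D n w <-> forall i, (i < n)%N -> ~~ (`|F w - z i| < e).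
  split=> [Dw i i_n|h].
    have : ~~ has (fun x => `|F w - x| < e) (zs n).
      by rewrite has_find -leqNgt -Dw.
    by move=> /hasPn; apply; apply: map_f; rewrite mem_iota.
  apply: hasNfind; apply/hasPn => x /mapP[i]; rewrite mem_iota/= add0n => hi ->.
  exact: h.
have mD n : measurable (D n).
  exact: (measurable_preimage_borel mF (cell_borel (zs n) e (size (zs n)))).
have mD0 : mu (\bigcap_n D n) = 0.
  apply/negligibleP; first exact: bigcapT_measurable.
  apply: negligibleS dz => w Dw dzw; have [k] := dzw e e0.
  by apply/negP; apply: (DP k.+1 w).1 => //; exact: Dw.
have : mu \o D @ \oo --> mu (\bigcap_n D n).
  apply: nonincreasing_cvg_mu => //.
  - by rewrite -ge0_fin_numE// fin_num_measure.
  - exact: bigcapT_measurable.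
  - move=> n m nm; apply/subsetPset => w /DP Dw; apply/DP => i i_n.
    by apply: Dw; exact: leq_trans nm.
rewrite mD0 => /fine_cvgP[_ /cvgrPdist_le/(_ _ e0)] [n _ /(_ n (leqnn n))] /=.
rewrite sub0r normrN => hn; exists (zs n).
rewrite -[leLHS]fineK; last by rewrite fin_num_measure//; exact: mD.
by rewrite lee_fin (le_trans (ler_norm _)).
Qed.

(** [J] is a Borel function of [radstrom (Psi w)], so that independence is
    inherited by the labels. The set attached to a ball is a value that [Psi]
    takes in it off a null event, or else [U], so that its differences lie in
    [L]. *)
Lemma discretization (e : R) : 0 < e ->
  exists m (J : Omega -> nat) (B : nat -> set (Zspace X)) (K : nat -> BC X) (Bad : set Omega),
  [/\ (forall w, (J w < m)%N),
      (forall c, borel_set (B c) /\ J @^-1` [set c] = F @^-1` (B c)),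
      (forall c, (forall a b, (K c : set X) a -> (K c : set X) b -> L (a - b)) /\
        forall a, (K c : set X) a -> `|a| <= M),
      measurable Bad /\ (mu Bad <= e%:E)%E &
      forall w, ~ Bad w -> `|F w - radstrom (K (J w))| <= 2 * e].
Proof.
move=> e0; have [zs junk] := small_junk e0.
have [N [mN N0 goodN]] := ae_diff_in_subspace rPsi PsiM UM EPsi LD LZ Lcl UL.
have {}goodN w : ~ N w -> forall a b, (Psi w : set X) a -> (Psi w : set X) b -> L (a - b).
  by move=> Nw; apply: contrapT => h; apply: Nw; exact: goodN.
pose J w := cell zs e (F w).
pose junkset := [set w | J w = size zs].
pose K c := if pselect (exists w, [/\ ~ N w, J w = c & (c < size zs)%N]) is left h
  then Psi (projT1 (cid h)) else U.
have mJ c : measurable (J @^-1` [set c]).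
  exact: (measurable_preimage_borel mF (cell_borel zs e c)).
exists (size zs).+1, J, (fun c => [set x | cell zs e x = c]), K, (N `|` junkset); split.
- by move=> w; rewrite ltnS find_size.
- by move=> c; split; first exact: cell_borel.
- move=> c; rewrite /K; case: pselect => [h|_]; last first.
    split=> // a b /UL La /UL Lb; rewrite -[b]opprK -scaleN1r.
    by apply: LD => //; rewrite scaleN1r opprK; rewrite -scaleN1r; exact: LZ.
  case: (cid h) => w [Nw _ _] /=; split; first exact: goodN.
  exact: PsiM.
- split; first by apply: measurableU => //; exact: mJ.
  apply: le_trans junk; rewrite -/junkset.
  have mjunk : measurable junkset by exact: mJ.
  have := measureU2 mu mN mjunk.
  by rewrite [X in (_ <= X + _)%E]N0 add0e.
- move=> w /not_orP[Nw Jw].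
  have Jlt : (J w < size zs)%N.
    by rewrite ltn_neqAle find_size andbT; apply/eqP.
  rewrite /K; case: pselect => [h|[]]; last by exists w.
  case: (cid h) => w' [Nw' Jw' _] /=.
  pose z := nth 0 zs (J w).
  have close w1 : J w1 = J w -> `|F w1 - z| <= e.
    move=> E; apply/ltW; rewrite /z -E; apply: (nth_find 0 (a := fun z => `|F w1 - z| < e)).
    by rewrite has_find -/(cell zs e (F w1)) -/(J w1) E.
  rewrite -(subrKA z) -[z - _]opprB mulr_natl mulr2n.
  exact: le_trans (ler_normB _ _) (lerD (close w erefl) (close w' Jw')).
Qed.

End discretization.

Section mean_of_discretization.
Context (R : realType) (X : normedModType R) d (Omega : measurableType d)
  (mu : probability Omega R).
Variables (Psi : Omega -> BC X) (U : BC X) (M : R).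
Hypothesis rPsi : random_set Psi.
Hypothesis PsiM : forall w a, (Psi w : set X) a -> `|a| <= M.
Hypothesis UM : forall a, (U : set X) a -> `|a| <= M.
Hypothesis EPsi : expectation_is mu Psi U.

(** Both sides are integrals of support functions at [f], whose integrands
    differ by at most [2 * e] outside [Bad] and by at most [2 * M] on it. *)
Lemma mean_close (e : R) (m : nat) (J : Omega -> nat) (K : nat -> BC X) (Bad : set Omega) :
  0 <= e -> (forall w, (J w < m)%N) ->
  (forall c, measurable (J @^-1` [set c])) ->
  (forall c a, (K c : set X) a -> `|a| <= M) ->
  measurable Bad -> (mu Bad <= e%:E)%E ->
  (forall w, ~ Bad w -> `|radstrom (Psi w) - radstrom (K (J w))| <= 2 * e) ->
  forall f, `|\sum_(c < m) fine (mu (J @^-1` [set (c : nat)])) * radstrom (K c) f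
    - radstrom U f| <= (2 + 2 * M) * e.
Proof.
move=> e0 Jm mJ KM mBad muBad close f.
have M0 : 0 <= M by have [a Ua] := BC_nonempty U; exact: le_trans (UM Ua).
have [intF IF] := integral_evaluation rPsi PsiM UM EPsi f.
have Jr w : J w \in iota 0 m by rewrite mem_iota Jm.
have [intK IK] := integral_finite_valued mu (fun c => radstrom (K c) f) (iota_uniq 0 m) Jr mJ.
rewrite -{1}[m]subn0 -/(index_iota 0 m) big_mkord in IK.
pose psi w : R := 2 * e + 2 * M * \1_Bad w.
have psi_ge w : `|radstrom (K (J w)) f - radstrom (Psi w) f| <= psi w.
  rewrite /psi; have [Bw|nBw] := pselect (Bad w).
    rewrite indicE mem_set// mulr1.
    apply: (@le_trans _ _ (M + M)); last by rewrite [2 * M]mulr_natl mulr2n lerDr mulr_ge0.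
    apply: le_trans (ler_normB _ _) (lerD _ _); apply: radstrom_abs_le => a.
      exact: KM.
    exact: PsiM.
  rewrite indicE memNset// mulr0 addr0 distrC.
  exact: le_trans (bcfun_le_norm (radstrom (Psi w) - radstrom (K (J w))) f) (close w nBw).
have mdiff : measurable_fun setT
    (fun w => (radstrom (K (J w)) f)%:E - (radstrom (Psi w) f)%:E)%E.
  by apply: emeasurable_funB; [have /integrableP[] := intK|have /integrableP[] := intF].
have i1 : mu.-integrable setT (fun=> (2 * e)%:E).
  by apply: finite_measure_integrable_cst.
have i2 : mu.-integrable setT (fun w => (2 * M)%:E * (\1_Bad w)%:E)%E.
  by apply: integrableZl => //; exact: integrable_indic.
have psiE w : (psi w)%:E = ((2 * e)%:E + (2 * M)%:E * (\1_Bad w)%:E)%E.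
  by rewrite -EFinM -EFinD.
have Ipsi : (\int[mu]_w (psi w)%:E <= ((2 + 2 * M) * e)%:E)%E.
  under eq_integral do rewrite psiE.
  rewrite integralD// [X in (X + _)%E](_ : _ = (2 * e)%:E); last first.
    by rewrite [LHS]integral_cst// [X in (_ * X)%E]probability_setT mule1.
  rewrite integralZl//; last exact: integrable_indic.
  rewrite integral_indic// setIT (_ : (2 + 2 * M) * e = 2 * e + 2 * M * e); last by ring.
  rewrite [leRHS]EFinD; apply: leeD => //; rewrite [leRHS](EFinM (2 * M) e).
  by rewrite lee_wpmul2l// lee_fin mulr_ge0.
rewrite -lee_fin (le_trans _ Ipsi)// -abse_EFin EFinB -IK -IF -integralB_EFin//.
apply: le_trans (le_abse_integral mu measurableT mdiff) _.
apply: ge0_le_integral => //.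
- exact: measurableT_comp.
- by under eq_fun do rewrite psiE; have /integrableP[] := integrableD measurableT i1 i2.
- by move=> w _; rewrite -EFinB abse_EFin lee_fin.
Qed.
End mean_of_discretization.

(** * Preparations for the law of large numbers for random sets *)

(** One of the two choices of the relative sign of two numbers makes them cancel
    in part. *)
Lemma B_convex_line (R : realType) : B_convex R^o.
Proof.
exists 2; split => //; exists 2^-1; split; first by rewrite invr_gt0.
move=> x x1; pose i0 : 'I_2 := ord0; pose i1 : 'I_2 := ord_max.
have h0 : `|x i0 : R| <= 1 := x1 i0; have h1 : `|x i1 : R| <= 1 := x1 i1.
have E (s : bool) : \sum_(i < 2) (-1) ^+ ((i == i1) && s) *: x i =
    (x i0 : R) + (-1) ^+ s * (x i1 : R).
  rewrite big_ord_recl big_ord1 (_ : lift ord0 ord0 = i1); last exact: val_inj.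
  by rewrite eqxx (_ : (ord0 == i1) = false)// expr0 scale1r.
have -> : (1 - 2^-1) * 2 = 1 :> R by lra.
move: h0 h1; rewrite !ler_norml => /andP[l0 u0] /andP[l1 u1].
have [p|n] := leP 0 ((x i0 : R) * (x i1 : R)).
  exists (fun i => (i == i1) && true); rewrite E expr1 ler_norml mulN1r.
  by apply/andP; split; have [a|a] := leP 0 (x i0 : R); nra.
exists (fun i => (i == i1) && false); rewrite E expr0 ler_norml mul1r.
by apply/andP; split; have [a|a] := leP 0 (x i0 : R); nra.
Qed.

Section hausdorff_misc.
Context (R : realType) (X : normedModType R).

Lemma rho_H_ge0 (A B : BC X) : 0 <= rho_H A B.
Proof.
have inf0 (C : set X) b : 0 <= inf [set `|a - b| | a in C].
  have [->|/set0P[c Cc]] := eqVneq C set0; first by rewrite image_set0 inf0.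
  by apply: lb_le_inf; [exists `|c - b|, c|move=> _ [a _ <-]].
rewrite le_max; apply/orP; left.
set S := [set _ | _ in _].
have [hs|hs] := pselect (has_sup S); last by rewrite sup_out.
have [b Bb] := BC_nonempty B.
by apply: le_trans (inf0 A b) (ub_le_sup hs.2 _); exists b.
Qed.

Lemma setnorm_ge (A : BC X) a : (A : set X) a -> `|a| <= setnorm A.
Proof.
move=> Aa; have [M _ AM] := BC_boundP A.
by apply: ub_le_sup; [exists M => _ [b Ab <-]; exact: AM|exists a].
Qed.

(** Recentred at [x], the support function sees [f] only on [A - x]. *)
Lemma support_translate_close (A : BC X) (x : X) (r : R) (f g : dual_sphere X) :
  (forall a, (A : set X) a ->
     `|(\val f : dual X) (a - x) - (\val g : dual X) (a - x)| <= r) ->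
  `|(radstrom A f - (\val f : dual X) x) - (radstrom A g - (\val g : dual X) x)| <= r.
Proof.
have half (f' g' : dual_sphere X) : (forall a, (A : set X) a ->
    (\val f' : dual X) (a - x) - (\val g' : dual X) (a - x) <= r) ->
    radstrom A f' - (\val f' : dual X) x <= radstrom A g' - (\val g' : dual X) x + r.
  move=> h; rewrite lerBlDr; apply: radstrom_le => a Aa.
  have := h a Aa; have := radstrom_ge g' Aa; rewrite !linearB/=; lra.
move=> h; rewrite ler_norml; apply/andP; split.
  rewrite lerNl opprB lerBlDl; apply: half => a Aa.
  by rewrite (le_trans _ (h a Aa))// distrC ler_norm.
rewrite lerBlDl; apply: half => a Aa.
by rewrite (le_trans _ (h a Aa))// ler_norm.
Qed.

End hausdorff_misc.

Section label_means.
Context (R : realType) d (Omega : measurableType d) (mu : probability Omega R).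
Variables (J : Omega -> nat) (m : nat).
Hypothesis (mJ : forall c, measurable (J @^-1` [set c])) (Jm : forall w, (J w < m)%N).

Definition label_mean (V : lmodType R) (x : nat -> V) : V :=
  \sum_(c < m) fine (mu (J @^-1` [set (c : nat)])) *: x c.

Lemma sum_label_prob : \sum_(c < m) fine (mu (J @^-1` [set (c : nat)])) = 1.
Proof.
have Jr w : J w \in iota 0 m by rewrite mem_iota Jm.
have [_] := integral_finite_valued mu (fun=> 1) (iota_uniq 0 m) Jr mJ.
rewrite -{1}[m]subn0 -/(index_iota 0 m) big_mkord.
rewrite [LHS]integral_cst// [X in (_ * X)%E]probability_setT mule1 => -[->].
by apply: eq_bigr => c _; rewrite mulr1.
Qed.

Lemma label_mean_centered (V : lmodType R) (x : nat -> V) :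
  \sum_(c < m) fine (mu (J @^-1` [set (c : nat)])) *: (x c - label_mean x) = 0.
Proof.
under eq_bigr do rewrite scalerBr.
by rewrite big_split/= sumrN -scaler_suml sum_label_prob scale1r subrr.
Qed.

Lemma label_mean_le (V : normedModType R) (x : nat -> V) (r : R) :
  (forall c, `|x c| <= r) -> `|label_mean x| <= r.
Proof.
move=> xr; rewrite (le_trans (ler_norm_sum _ _ _))// -[leRHS]mul1r -sum_label_prob.
rewrite mulr_suml ler_sum// => c _.
by rewrite normrZ ger0_norm ?fine_ge0// ler_wpM2l// fine_ge0.
Qed.

End label_means.

(** * The law of large numbers for random sets *)

Lemma sum_initial_le (R : realType) (c : R) (i0 k : nat) : 0 <= c ->
  \sum_(i < k) (if (i < i0)%N then c else 0) <= i0%:R * c.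
Proof.
move=> c0; have -> : \sum_(i < k) (if (i < i0)%N then c else 0) = (minn k i0)%:R * c.
  rewrite -(big_mkord xpredT (fun i => if (i < i0)%N then c else 0)).
  elim: k => [|k IH]; first by rewrite big_nil min0n mul0r.
  rewrite big_nat_recr// IH; case: ltnP => h.
    by rewrite (minn_idPl h) -natr1 mulrDl mul1r.
  by rewrite (minn_idPr (leqW h)) [LHS]addr0.
by rewrite ler_wpM2r// ler_nat geq_minr.
Qed.

Section assembly.
Context (R : realType) (X : normedModType R) d (Omega : measurableType d)
  (mu : probability Omega R).
Variables (U : BC X) (Psi : nat -> Omega -> BC X) (M : R) (n : nat) (e : 'I_n -> X).
Hypothesis PsiM : forall i w a, (Psi i w : set X) a -> `|a| <= M.
Variables (J : nat -> Omega -> nat) (m : nat -> nat) (K : nat -> nat -> BC X)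
  (Bad : nat -> set Omega) (del : nat -> R) (D : R).
Hypothesis mJ : forall i c, measurable (J i @^-1` [set c]).
Hypothesis Jm : forall i w, (J i w < m i)%N.
Hypothesis indJ : independent_labels mu J.
Hypothesis KL : forall i c a b, (K i c : set X) a -> (K i c : set X) b ->
  lin_span (range e) (a - b).
Hypothesis KM : forall i c a, (K i c : set X) a -> `|a| <= M.
Hypothesis del0 : forall i, 0 <= del i.
Hypothesis sum_del : forall k, \sum_(0 <= i < k) del i <= D.
Hypothesis mBad : forall i, measurable (Bad i).
Hypothesis muBad : forall i, (mu (Bad i) <= (del i)%:E)%E.
Hypothesis close : forall i w, ~ Bad i w ->
  `|radstrom (Psi i w) - radstrom (K i (J i w))| <= 2 * del i.
Hypothesis mean_K : forall i f,
  `|label_mean mu (J i) (m i) (fun c => radstrom (K i c) f : R^o) - radstrom U f|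
    <= (2 + 2 * M) * del i.

Let x i c : X := projT1 (cid (BC_nonempty (K i c))).
Let Kx i c : (K i c : set X) (x i c). Proof. exact: projT2 (cid _). Qed.
Let mean (V : lmodType R) i (y : nat -> V) := label_mean mu (J i) (m i) y.
Let a i c : X := x i c - mean i (x i).
Let u i (f : dual_sphere X) c : R^o := radstrom (K i c) f - (\val f : dual X) (x i c).
Let t i (f : dual_sphere X) c : R^o := u i f c - mean i (u i f).

Let M0 : 0 <= M. Proof. exact: le_trans (KM (Kx 0 0)). Qed.

Let x_le i c : `|x i c| <= M. Proof. exact: KM (Kx i c). Qed.

Let u_le i f c : `|u i f c| <= M + M.
Proof.
apply: le_trans (ler_normB _ _) (lerD _ _).
  by apply: radstrom_abs_le; exact: KM.
exact: le_trans (sphere_le f _) (x_le i c).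
Qed.

Let a_le i c : `|a i c| <= M + M.
Proof.
apply: le_trans (ler_normB _ _) (lerD (x_le i c) _).
exact: (label_mean_le mu (mJ i) (Jm i) (x_le i)).
Qed.

Let t_le i f c : `|t i f c| <= (M + M) + (M + M).
Proof.
apply: le_trans (ler_normB _ _) (lerD (u_le i f c) _).
exact: (label_mean_le mu (V := R^o) (mJ i) (Jm i) (u_le i f)).
Qed.

(** The deviation of one support function splits into the fluctuation of a
    point of [X], that of a scalar depending on [f] only through its
    restriction to the subspace, and summable errors. *)
Let decomposition i f w : radstrom (Psi i w) f - radstrom U f =
  (radstrom (Psi i w) f - radstrom (K i (J i w)) f) +
  (mean i (fun c => radstrom (K i c) f : R^o) - radstrom U f) +
  (\val f : dual X) (a i (J i w)) + t i f (J i w).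
Proof.
have -> : mean i (fun c => radstrom (K i c) f : R^o) =
    (\val f : dual X) (mean i (x i)) + mean i (u i f).
  rewrite /mean /label_mean linear_sum -big_split/=; apply: eq_bigr => c _.
  by rewrite linearZ -scalerDr addrC subrK.
by rewrite /a linearB /t /u; ring.
Qed.

(** Differences of points of [K i c] belong to the subspace, so [t i] varies
    little between functionals that are close there. *)
Let t_close i f g c (r : R) : (forall v, lin_span (range e) v -> `|v| <= M + M ->
    `|(\val f : dual X) v - (\val g : dual X) v| <= r) ->
  `|t i f c - t i g c| <= 2 * r.
Proof.
move=> fg.
have uc c' : `|u i f c' - u i g c'| <= r.
  apply: support_translate_close => b Kb; apply: fg; first exact: KL (Kx i c').
  exact: le_trans (ler_normB _ _) (lerD (KM Kb) (x_le i c')).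
have E : t i f c - t i g c = (u i f c - u i g c) - mean i (fun c => u i f c - u i g c : R^o).
  have -> : mean i (fun c => u i f c - u i g c : R^o) = mean i (u i f) - mean i (u i g).
    rewrite /mean /label_mean -sumrN -big_split/=; apply: eq_bigr => c' _.
    by rewrite scalerBr.
  by rewrite /t; ring.
rewrite E mulr_natl mulr2n; apply: le_trans (ler_normB _ _) (lerD (uc c) _).
exact: (label_mean_le mu (V := R^o) (mJ i) (Jm i) uc).
Qed.

Let psi_close_le i w : `|radstrom (Psi i w) - radstrom (K i (J i w))| <= M + M.
Proof.
apply: bcfun_norm_le => [|f]; first by rewrite addr_ge0.
apply: le_trans (ler_normB _ _) (lerD _ _); apply: radstrom_abs_le.
  exact: PsiM.
exact: KM.
Qed.

(** The errors of [decomposition] are summable once the exceptional sets are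
    left behind. *)
Let error_sum w i0 : (forall i, (i0 <= i)%N -> ~ Bad i w) -> forall f k,
  `|\sum_(i < k) ((radstrom (Psi i w) f - radstrom (K i (J i w)) f) +
     (mean i (fun c => radstrom (K i c) f : R^o) - radstrom U f))|
  <= i0%:R * (M + M) + (4 + 2 * M) * D.
Proof.
move=> nBad f k.
rewrite (le_trans (ler_norm_sum _ _ _))//.
apply: (@le_trans _ _ (\sum_(i < k) ((if (i < i0)%N then M + M else 0) +
    (4 + 2 * M) * del i))).
  apply: ler_sum => i _; rewrite (le_trans (ler_normD _ _))//.
  have h1 := bcfun_le_norm (radstrom (Psi i w) - radstrom (K i (J i w))) f.
  have h2 := mean_K i f.
  have -> : (4 + 2 * M) * del i = 2 * del i + (2 + 2 * M) * del i by ring.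
  rewrite addrA lerD//; apply: le_trans h1 _; case: ltnP => ii0.
    by rewrite (le_trans (psi_close_le i w))// lerDl mulr_ge0.
  by rewrite add0r; apply: close; exact: nBad.
rewrite big_split/=; apply: lerD; last first.
  rewrite -mulr_sumr -(big_mkord xpredT del) ler_wpM2l//.
  by rewrite addr_ge0// mulr_ge0.
by apply: sum_initial_le; rewrite addr_ge0.
Qed.

(** Uniformly in [f], the sum of the deviations is bounded by four terms, each
    of them at most [r / 4] times the number of sets: the summable errors, the sum
    of the centred points, the sum of the [t i g] for a member [g] of the net that
    is close to [f], and the replacement of [f] by [g]. *)
Lemma ae_cvg_rho_H : B_convex X -> {ae mu, forall w,
  rho_H (BCscale k.+1%:R^-1 (\big[@BCadd R X/BC0 X]_(i < k.+1) Psi i w)) U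
    @[k --> \oo] --> (0 : R)}.
Proof.
move=> XB.
have A1 := label_slln mJ Jm indJ a_le
  (fun i => label_mean_centered mu (mJ i) (Jm i) (x i)) XB.
have netP (q : nat) : exists p : {k & 'I_k -> dual_sphere X},
    forall f : dual_sphere X, exists i, forall v, lin_span (range e) v -> `|v| <= M + M ->
      `|(\val f : dual X) v - (\val (projT2 p i) : dual X) v| <= q.+1%:R^-1.
  have q0 : (0 : R) < q.+1%:R^-1 by rewrite invr_gt0.
  have [k [g hg]] := dual_sphere_net e (M + M) q0.
  by exists (existT (fun k => 'I_k -> dual_sphere X) k g).
have {netP}[net netP] := choice netP.
have A2 : {ae mu, forall w q (j : 'I_(projT1 (net q))), forall r, 0 < r ->
    exists t0, forall k, (t0 <= k)%N ->
      `|\sum_(i < k) t i (projT2 (net q) j) (J i w)| <= r * k%:R}.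
  apply/ae_foralln => q; apply: filter_forall => j.
  set f := projT2 (net q) j.
  exact: (label_slln mJ Jm indJ (fun i => t_le i f)
    (fun i => label_mean_centered mu (V := R^o) (mJ i) (Jm i) (u i f)) (B_convex_line R)).
have A3 := eventually_notin mBad muBad sum_del.
apply: filterS3 A1 A2 A3 => w w1 w2 [i0 w3].
apply/cvgrPdist_le => r r0.
have r4 : 0 < r / 4 by rewrite divr_gt0.
(* the error of the net, doubled by centring, is below [r / 4] *)
pose q := Num.truncn (2 / (r / 4)).
have qr : 2 * q.+1%:R^-1 <= r / 4.
  by rewrite ler_pdivrMr// mulrC -ler_pdivrMr// ltW// truncnS_gt.
have [T hT] := choice (fun j => w2 q j _ r4).
have [t1 ht1] := w1 _ r4.
pose C := i0%:R * (M + M) + (4 + 2 * M) * D.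
pose t2 := Num.truncn (C / (r / 4)).
exists (maxn (maxn t1 t2) (\max_j T j)) => // k /=.
rewrite !geq_max => /andP[/andP[k1 k2] /bigmax_leqP kT].
rewrite sub0r normrN ger0_norm ?rho_H_ge0//.
apply: le_trans (rho_H_le_radstrom _ _) _.
apply: bcfun_norm_le => [|f]; first exact: ltW.
rewrite [X in `|X|](_ : _ = k.+1%:R^-1 *
    \sum_(i < k.+1) (radstrom (Psi i w) f - radstrom U f)); last first.
  rewrite -[LHS]/(radstrom _ f - radstrom U f) (radstrom_mean (fun i => Psi i w)).
  by rewrite big_split/= sumrN sumr_const card_ord mulrBr -[radstrom U f *+ _]mulr_natl mulKf.
rewrite normrM ger0_norm ?invr_ge0// ler_pdivrMl// mulrC.
have [j hj] := netP q f; set g := projT2 (net q) j in hj.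
have -> : \sum_(i < k.+1) (radstrom (Psi i w) f - radstrom U f) =
  \sum_(i < k.+1) ((radstrom (Psi i w) f - radstrom (K i (J i w)) f) +
     (mean i (fun c => radstrom (K i c) f : R^o) - radstrom U f)) +
  ((\val f : dual X) (\sum_(i < k.+1) a i (J i w)) +
  (\sum_(i < k.+1) t i g (J i w) +
   \sum_(i < k.+1) (t i f (J i w) - t i g (J i w)))).
  rewrite linear_sum -!big_split/=; apply: eq_bigr => i _.
  by rewrite decomposition [t i g _ + _]addrC subrK addrA.
have b1 : C <= r / 4 * k.+1%:R.
  rewrite mulrC -ler_pdivrMr// ltW// (lt_le_trans (truncnS_gt _))// ler_nat.
  by rewrite ltnS.
have b2 := le_trans (sphere_le f _) (ht1 k.+1 (leqW k1)).
have b3 := hT j k.+1 (leqW (kT j isT)).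
have b4 : `|\sum_(i < k.+1) (t i f (J i w) - t i g (J i w))| <= r / 4 * k.+1%:R.
  rewrite (le_trans (ler_norm_sum _ _ _))//.
  apply: (@le_trans _ _ (\sum_(i < k.+1) (r / 4))).
    by apply: ler_sum => i _; exact: le_trans (t_close i (J i w) hj) qr.
  by rewrite sumr_const card_ord mulr_natr.
have b0 := le_trans (error_sum w3 f k.+1) b1.
apply: le_trans (ler_normD _ _) _.
apply: le_trans (lerD b0 (le_trans (ler_normD _ _)
  (lerD b2 (le_trans (ler_normD _ _) (lerD b3 b4))))) _.
rewrite -!mulrDl ler_wpM2r//; lra.
Qed.

End assembly.

Theorem corollary6p2 (R : realType) (X : completeNormedModType R)
    (d : measure_display) (Omega : measurableType d) (mu : probability Omega R)
    (U : BC X) (Psi : nat -> Omega -> BC X) :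
  B_convex X ->
  finite_dimensional (closure (lin_span U)) ->
  (forall n, random_set (Psi n)) ->
  uniformly_bounded Psi ->
  independent_random_sets mu Psi ->
  (forall n, expectation_is mu (Psi n) U) ->
  {ae mu, forall w,
    rho_H (BCscale n.+1%:R^-1 (\big[@BCadd R X/BC0 X]_(i < n.+1) Psi i w)) U
      @[n --> \oo] --> (0 : R)}.
Proof.
move=> XB [n [e Le]] rPsi [M1 bPsi] ind EPsi.
have [M2 M20 UM2] := BC_boundP U.
pose M := Num.max M1 M2.
have PsiM i w a : (Psi i w : set X) a -> `|a| <= M.
  move=> Pa; rewrite le_max (le_trans (setnorm_ge Pa))//.
  by apply: bPsi; exists i => //; exists w.
have UM a : (U : set X) a -> `|a| <= M.
  by move=> Ua; rewrite le_max UM2// orbT.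
pose L := lin_span (range e).
have Lcl : closed L by rewrite /L -Le; exact: closed_closure.
have UL : (U : set X) `<=` L.
  by rewrite /L -Le => a Ua; apply: subset_closure; exact: sub_lin_span.
have LD : forall x y, L x -> L y -> L (x + y) by exact: lin_spanD.
have LZ : forall (t : R) x, L x -> L (t *: x) by move=> t x; exact: lin_spanZ.
pose del i : R := 2^-1 ^+ i.
have del0 i : 0 < del i by rewrite exprn_gt0// invr_gt0.
have sum_del k : \sum_(0 <= i < k) del i <= (1 - 2^-1)^-1.
  by apply: geometric_partial_le; rewrite invr_ge0/= ler0n/= invf_lt1// ltr1n.
have disc i : exists q : nat * (Omega -> nat) * (nat -> set (Zspace X)) *
    (nat -> BC X) * set Omega, let: (m, J, B, K, Bad) := q in
  [/\ (forall w, (J w < m)%N),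
      (forall c, borel_set (B c) /\
        J @^-1` [set c] = (fun w => radstrom (Psi i w)) @^-1` (B c)),
      (forall c, (forall a b, (K c : set X) a -> (K c : set X) b -> L (a - b)) /\
        forall a, (K c : set X) a -> `|a| <= M),
      measurable Bad /\ (mu Bad <= (del i)%:E)%E &
      forall w, ~ Bad w -> `|radstrom (Psi i w) - radstrom (K (J w))| <= 2 * del i].
  have [m [J [B [K [Bad h]]]]] :=
    discretization (rPsi i) (PsiM i) UM (EPsi i) LD LZ Lcl UL (del0 i).
  by exists (m, J, B, K, Bad).
have {disc}[q hq] := choice disc.
pose m i := (q i).1.1.1.1; pose J i := (q i).1.1.1.2; pose B i := (q i).1.1.2.
pose K i := (q i).1.2; pose Bad i := (q i).2.
have {}hq i : [/\ (forall w, (J i w < m i)%N),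
      (forall c, borel_set (B i c) /\
        J i @^-1` [set c] = (fun w => radstrom (Psi i w)) @^-1` (B i c)),
      (forall c, (forall a b, (K i c : set X) a -> (K i c : set X) b -> L (a - b)) /\
        forall a, (K i c : set X) a -> `|a| <= M),
      measurable (Bad i) /\ (mu (Bad i) <= (del i)%:E)%E &
      forall w, ~ Bad i w -> `|radstrom (Psi i w) - radstrom (K i (J i w))| <= 2 * del i].
  by have := hq i; rewrite /m /J /B /K /Bad; case: (q i) => [[[[? ?] ?] ?] ?].
have Jm i w : (J i w < m i)%N by have [] := hq i.
have BJ i c : borel_set (B i c) /\
    J i @^-1` [set c] = (fun w => radstrom (Psi i w)) @^-1` (B i c).
  by have [_ + _ _ _] := hq i; apply.
have mJ i c : measurable (J i @^-1` [set c]).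
  by have [bB ->] := BJ i c; apply: measurable_preimage_borel bB; exact: rPsi.
have indJ : independent_labels mu J.
  move=> S c; have := ind S (fun j => B j (c j)) (fun j _ => (BJ j (c j)).1).
  under eq_bigr do rewrite -[X in mu X](BJ _ _).2.
  move=> <-; congr (mu _); apply: eq_bigcapr => j _; exact: (BJ j (c j)).2.
have KM i c a : (K i c : set X) a -> `|a| <= M.
  by have [_ _ + _ _] := hq i => /(_ c)[_]; apply.
apply: (@ae_cvg_rho_H R X d Omega mu U Psi M n e PsiM J m K Bad del _ mJ Jm indJ
  _ KM (fun i => ltW (del0 i)) sum_del) => //.
- by move=> i c; have [_ _ + _ _] := hq i => /(_ c)[].
- by move=> i; have [_ _ _ []] := hq i.
- by move=> i; have [_ _ _ []] := hq i.
- by move=> i; have [] := hq i.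
move=> i f; have [_ _ _ [mBad muBad] close] := hq i.
exact: (mean_close (rPsi i) (PsiM i) UM (EPsi i) (ltW (del0 i)) (Jm i) (mJ i) (KM i)
  mBad muBad close f).
Qed.
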